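(* Every strictly supersolvable locally geometric poset is inductive.
   Context: All posets are finite, have a unique minimal element $\hat 0$, and are ranked (for every $x$ all maximal chains with top $x$ have the same length $\operatorname{rk}(x)$); $\operatorname{rk}(\mathcal{P}):=\max_x\operatorname{rk}(x)$. Characteristic polynomial: $\chi_{\mathcal{P}}(t)=\sum_{x}\mu(\hat0,x)t^{\operatorname{rk}(\mathcal{P})-\operatorname{rk}(x)}$, $\mu$ the Möbius function. $A(\mathcal{P})$ is the set of atoms (rank-1 elements). For $T\subseteq\mathcal{P}$, $\bigvee T$ is the set of minimal upper bounds of $T$; $x\vee y:=\bigvee\{x,y\}$. A lattice is geometric if for all $x,y$: $y$ covers $x$ iff there is an atom $a\not\le x$ with $y=x\vee a$. $\mathcal{P}$ is locally geometric if every $\mathcal{P}_{\le x}$ is a geometric lattice. An element $x$ of a geometric lattice $L$ is modular if $x\wedge(y\vee z)=(x\wedge y)\vee z$ for all $z\le x$, $y\in L$. For $B\subseteq A(\mathcal{P})$, $\mathcal{P}(B)$ is the subposet consisting of $\hat 0$ and all elements of $\bigvee T$ for nonempty $T\subseteq B$. An order ideal $\mathcal{Q}$ is pure if all its maximal elements have the same rank, and join-closed if $T\subseteq\mathcal{Q}$ implies $\bigvee T\subseteq\mathcal{Q}$. An M-ideal of a locally geometric $\mathcal{P}$ is a pure, join-closed order ideal $\mathcal{Q}$ with (1) $|a\vee y|\ge1$ for all $y\in\mathcal{Q}$, $a\in A(\mathcal{P})\setminus A(\mathcal{Q})$, and (2) for every maximal $x\in\mathcal{P}$ there is a maximal $y\in\mathcal{Q}$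 that is modular in $\mathcal{P}_{\le x}$. A TM-ideal is an M-ideal satisfying the stronger (1* ) $|a\vee y|=1$ for all such $y,a$. $\mathcal{P}$ is strictly supersolvable if there is a chain $\{\hat0\}=\mathcal{Q}_0\subsetneq\mathcal{Q}_1\subsetneq\cdots\subsetneq\mathcal{Q}_r=\mathcal{P}$ with each $\mathcal{Q}_i$ a TM-ideal of $\mathcal{Q}_{i+1}$ and $\operatorname{rk}(\mathcal{Q}_i)=i$. For an atom $a$, let $\mathcal{P}':=\mathcal{P}(A(\mathcal{P})\setminus\{a\})$ and $\mathcal{P}'':=\mathcal{P}_{\ge a}$ (minimal element $a$, rank function $\operatorname{rk}-1$). The class of inductive posets is the smallest class of locally geometric posets such that (1) $\{\hat0\}$ is inductive, and (2) $\mathcal{P}$ is inductive whenever there is an atom $a$ with $\mathcal{P}''$ and $\mathcal{P}'$ inductive and $\chi_{\mathcal{P}''}(t)$ dividing $\chi_{\mathcal{P}'}(t)$. *)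

(* Defs.v *)
(* Posets are finite subsets P : {set T} of an ambient
   finite type T, ordered by the restriction of a fixed relation le
   (assumed to be a partial order on T in the main theorem). *)
From mathcomp Require Import all_boot all_order all_algebra.
Set Implicit Arguments. Unset Strict Implicit. Unset Printing Implicit Defensive.
Import GRing.Theory.

Section Posets.
Variables (T : finType) (le : rel T).

Definition lt (x y : T) : bool := le x y && (x != y).

Definition downset (P : {set T}) (x : T) : {set T} := [set y in P | le y x].
Definition upset (P : {set T}) (x : T) : {set T} := [set y in P | le x y].

Definition botset (P : {set T}) : {set T} :=
  [set z in P | [forall y in P, le z y]].

(* P has a unique minimal element (for finite posets: a least element) *)
Definition has_hat0 (P : {set T}) : Prop := exists z, botset P = [set z].

Definition chainb (C : {set T}) : bool :=
  [forall x in C, [forall y in C, le x y || le y x]].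

Definition hgt (P : {set T}) (x : T) : nat :=
  \max_(C : {set T} | (C \subset downset P x) && chainb C) #|C|.

Definition rk (P : {set T}) (x : T) : nat := (hgt P x).-1.

Definition ranked (P : {set T}) : Prop :=
  forall x, x \in P -> forall C : {set T},
    maxset [pred D : {set T} | (D \subset downset P x) && chainb D] C ->
    #|C| = hgt P x.

Definition poset_ok (P : {set T}) : Prop := has_hat0 P /\ ranked P.

Definition rkP (P : {set T}) : nat := \max_(x in P) rk P x.

Definition atoms (P : {set T}) : {set T} := [set x in P | rk P x == 1%N].

Definition maxel (P : {set T}) : {set T} :=
  [set x in P | [forall y in P, ~~ lt x y]].

Definition ubs (P : {set T}) (S : {set T}) : {set T} :=
  [set y in P | [forall s in S, le s y]].
Definition joins (P : {set T}) (S : {set T}) : {set T} :=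
  [set y in ubs P S | [forall z in ubs P S, le z y ==> (z == y)]].
Definition lbs (P : {set T}) (S : {set T}) : {set T} :=
  [set y in P | [forall s in S, le y s]].
Definition meets (P : {set T}) (S : {set T}) : {set T} :=
  [set y in lbs P S | [forall z in lbs P S, le y z ==> (z == y)]].

(* binary join / meet as elements (meaningful inside a lattice) *)
Definition jn (L : {set T}) (x y : T) : T := odflt x [pick z in joins L [set x; y]].
Definition mt (L : {set T}) (x y : T) : T := odflt x [pick z in meets L [set x; y]].

Definition is_lattice (L : {set T}) : Prop :=
  forall x y, x \in L -> y \in L ->
    (exists z, joins L [set x; y] = [set z]) /\
    (exists z, meets L [set x; y] = [set z]).

Definition covers (L : {set T}) (x y : T) : bool :=
  [&& x \in L, y \in L, lt x y & [forall z in L, ~~ (lt x z && lt z y)]].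

Definition geometric (L : {set T}) : Prop :=
  is_lattice L /\
  forall x y, x \in L -> y \in L ->
    (covers L x y <->
     exists2 a, a \in atoms L & ~~ le a x /\ joins L [set x; a] = [set y]).

Definition locally_geometric (P : {set T}) : Prop :=
  forall x, x \in P -> geometric (downset P x).

Definition modular_el (L : {set T}) (x : T) : Prop :=
  x \in L /\
  forall y z, y \in L -> z \in L -> le z x ->
    mt L x (jn L y z) = jn L (mt L x y) z.

Definition order_ideal (P Q : {set T}) : Prop :=
  Q \subset P /\ forall x y, x \in P -> y \in Q -> le x y -> x \in Q.

Definition pure (Q : {set T}) : Prop :=
  forall x y, x \in maxel Q -> y \in maxel Q -> rk Q x = rk Q y.

Definition join_closed (P Q : {set T}) : Prop :=
  forall S : {set T}, S \subset Q -> joins P S \subset Q.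

Definition M_ideal (P Q : {set T}) : Prop :=
  [/\ order_ideal P Q, pure Q, join_closed P Q,
      (forall y a, y \in Q -> a \in atoms P :\: atoms Q ->
         (1 <= #|joins P [set a; y]|)%N) &
      (forall x, x \in maxel P ->
         exists2 y, y \in maxel Q & modular_el (downset P x) y)].

Definition TM_ideal (P Q : {set T}) : Prop :=
  [/\ order_ideal P Q, pure Q, join_closed P Q,
      (forall y a, y \in Q -> a \in atoms P :\: atoms Q ->
         #|joins P [set a; y]| = 1%N) &
      (forall x, x \in maxel P ->
         exists2 y, y \in maxel Q & modular_el (downset P x) y)].

Definition strictly_supersolvable (P : {set T}) : Prop :=
  exists (r : nat) (Q : nat -> {set T}),
    [/\ Q 0%N = botset P, Q r = P,
        (forall i, (i < r)%N -> Q i \proper Q i.+1 /\ TM_ideal (Q i.+1) (Q i)) &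
        (forall i, (i <= r)%N -> rkP (Q i) = i)].

Local Open Scope ring_scope.

(* Moebius function, by the usual recursion
   mu(x,x) = 1, mu(x,y) = - sum_{x <= z < y} mu(x,z) for x < y, 0 otherwise;
   the fuel n = #|P| is sufficient. *)
Fixpoint mu_rec (P : {set T}) (n : nat) (x y : T) : int :=
  match n with
  | 0%N => if x == y then 1 else 0
  | n'.+1 =>
      if x == y then 1
      else if le x y then - (\sum_(z in P | le x z && lt z y) mu_rec P n' x z)
      else 0
  end.
Definition mu (P : {set T}) (x y : T) : int := mu_rec P #|P| x y.

(* characteristic polynomial  sum_x mu(0^,x) t^(rk P - rk x)
   (the outer sum ranges over the singleton {0^}) *)
Definition charpoly (P : {set T}) : {poly int} :=
  \sum_(z in botset P) \sum_(x in P)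
     (mu P z x)%:P * 'X^(rkP P - rk P x)%N.

Local Close Scope ring_scope.

Definition sub_atoms (P B : {set T}) : {set T} :=
  botset P :|: \bigcup_(S : {set T} | (S \subset B) && (S != set0)) joins P S.

Definition deletion (P : {set T}) (a : T) : {set T} := sub_atoms P (atoms P :\ a).
Definition restriction (P : {set T}) (a : T) : {set T} := upset P a.

Definition pdivides (p q : {poly int}) : Prop := exists r : {poly int}, q = (r * p)%R.

Inductive inductive_poset : {set T} -> Prop :=
| ind_base z : inductive_poset [set z]
| ind_step (P : {set T}) (a : T) :
    poset_ok P -> locally_geometric P -> a \in atoms P ->
    inductive_poset (restriction P a) ->
    inductive_poset (deletion P a) ->
    pdivides (charpoly (restriction P a)) (charpoly (deletion P a)) ->
    inductive_poset P.

End Posets.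

(* Main.v *)
Require Import Defs.
From mathcomp Require Import all_boot all_order all_algebra.
Set Implicit Arguments. Unset Strict Implicit. Unset Printing Implicit Defensive.
Import GRing.Theory.

(* If Q is a TM-ideal of P with rk P = rk Q + 1, let p x be the largest element
   of Q below x.  Modularity shows that every x outside Q covers p x and lies
   above some atom b outside Q; then y |-> b v y is an isomorphism from Q onto
   P_{>= b} with inverse p.  Hence P is Q together with one copy of Q above each
   of the k atoms outside Q.  The restriction to such an atom is isomorphic to Q,
   the deletion has the same shape with k - 1 atoms, and the Moebius function
   satisfies mu(x) = - #{b <= x} mu(p x) outside Q, so that
   chi_P = (t - k) chi_Q.  Induction on k shows that P is inductive when Q is, and
   this is applied along the chain of TM-ideals. *)

(** * Finite posets and joins *)

(** The induction on k carries the data of [extension] rather than the TM-ideal conditions: after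
    deleting an atom, purity and modularity would have to be proved again, whereas the same
    projection and lifts serve with one atom fewer. With several joins, as an M-ideal allows, P_{>=
    b} need not be a single copy of Q. That x covers p x comes from a rank count, where rk P <= rk Q
    + 1 enters; that x lies above an atom outside Q comes from join-closure and local geometricity.
    The delicate part is the deletion, which loses every element outside Q whose only new atom is
    the deleted one: covers, joins, meets and the geometric condition must be shown to survive this
    loss. The restriction is isomorphic but not equal to Q, so inductivity is first shown to be
    invariant under order embeddings. *)

(* [le] is kept generic here so that every lemma also applies to the opposite order. *)
Section FinitePosets.
Variables (T : finType) (le : rel T).
Hypotheses (le_refl : reflexive le) (le_anti : antisymmetric le).
Hypothesis le_trans : transitive le.
Implicit Types (P Q D S C : {set T}) (x y z w m : T).

Local Notation "x '⊑' y" := (le x y) (at level 70, no associativity).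
Local Notation "x '⊏' y" := (lt le x y) (at level 70, no associativity).

Lemma le_asym x y : x ⊑ y -> y ⊑ x -> x = y.
Proof. by move=> xy yx; apply: le_anti; rewrite xy. Qed.

Lemma ltW x y : x ⊏ y -> x ⊑ y. Proof. by case/andP. Qed.

Lemma lt_neq x y : x ⊏ y -> x != y. Proof. by case/andP. Qed.

Lemma lt_irr x : ~~ (x ⊏ x). Proof. by rewrite /lt eqxx andbF. Qed.

Lemma le_lt_trans x y z : x ⊑ y -> y ⊏ z -> x ⊏ z.
Proof.
move=> xy /andP[yz nyz]; rewrite /lt (le_trans xy yz).
by apply: contraNneq nyz => xz; apply/eqP/le_asym; rewrite // -xz.
Qed.

Lemma lt_le_trans x y z : x ⊏ y -> y ⊑ z -> x ⊏ z.
Proof.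
move=> /andP[xy nxy] yz; rewrite /lt (le_trans xy yz).
by apply: contraNneq nxy => xz; apply/eqP/le_asym; rewrite // xz.
Qed.

Lemma le_eqVlt x y : x ⊑ y -> (x = y) \/ (x ⊏ y).
Proof. by move=> xy; case: (eqVneq x y) => [|n]; [left | right; rewrite /lt xy]. Qed.

Lemma downset_proper P x y : x ⊏ y -> y \in P -> downset le P x \proper downset le P y.
Proof.
move=> xy yP; apply/properP; split.
  by apply/subsetP=> w; rewrite !inE => /andP[-> wx]; apply: le_trans (ltW xy).
exists y; rewrite !inE yP ?le_refl //=.
apply/negP=> yx; have := lt_neq xy.
by rewrite (le_asym (ltW xy) yx) eqxx.
Qed.

Lemma lt_ind (D : {set T}) (K : T -> Prop) :
  (forall x, x \in D -> (forall y, y \in D -> y ⊏ x -> K y) -> K x) ->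
  forall x, x \in D -> K x.
Proof.
move=> IH x; have [n] := ubnP #|downset le D x|; elim: n x => // n IHn x le_n xD.
apply: IH => // y yD yx; apply: IHn => //.
by rewrite -ltnS; apply: leq_trans le_n; rewrite ltnS proper_card ?downset_proper.
Qed.

Lemma exists_minimal D x : x \in D ->
  exists m, [/\ m \in D, m ⊑ x & forall w, w \in D -> w ⊑ m -> w = m].
Proof.
move: x; apply: lt_ind => x xD IH.
case: (pickP [pred w in D | w ⊏ x]) => [w /andP[wD wx]|none].
  have [m [mD mw mmin]] := IH w wD wx; exists m; split=> //.
  exact: le_trans mw (ltW wx).
exists x; split=> // w wD wx; case: (le_eqVlt wx) => // wx'.
by have := none w; rewrite inE wD wx'.
Qed.

Lemma joinsP D S j :
  reflect [/\ j \in D, forall s, s \in S -> s ⊑ j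
            & forall w, w \in D -> (forall s, s \in S -> s ⊑ w) -> w ⊑ j -> w = j]
          (j \in joins le D S).
Proof.
have ubsP w : reflect (w \in D /\ forall s, s \in S -> s ⊑ w) (w \in ubs le D S).
  rewrite inE; apply: (iffP andP) => -[-> h]; split=> //.
    by move=> s sS; move/forallP/(_ s): h; rewrite sS.
  by apply/forallP=> s; apply/implyP/h.
rewrite inE; apply: (iffP andP) => [[/ubsP[jD Sj] jmin]|[jD Sj jmin]].
  split=> // w wD Sw wj; move/forallP/(_ w): jmin.
  by rewrite wj; have /ubsP -> := conj wD Sw; move/eqP.
split; first exact/ubsP.
apply/forallP=> w; apply/implyP=> /ubsP[wD Sw]; apply/implyP=> wj.
by apply/eqP/jmin.
Qed.

Lemma exists_join_below D S y : y \in D -> (forall s, s \in S -> s ⊑ y) ->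
  exists2 j, j \in joins le D S & j ⊑ y.
Proof.
move=> yD Sy; have [|j [jU jy jmin]] := @exists_minimal (ubs le D S) y.
  by rewrite inE yD; apply/forallP=> s; apply/implyP/Sy.
exists j => //; rewrite inE jU; apply/forallP=> w; apply/implyP=> wU.
by apply/implyP=> wj; apply/eqP/jmin.
Qed.

Definition lub2 D x y j :=
  [/\ j \in D, x ⊑ j, y ⊑ j & forall w, w \in D -> x ⊑ w -> y ⊑ w -> j ⊑ w].

Lemma lub2_uniq D x y j k : lub2 D x y j -> lub2 D x y k -> j = k.
Proof. by move=> [jD xj yj jl] [kD xk yk kl]; apply: le_asym; [apply: jl | apply: kl]. Qed.

(** By finiteness every upper bound lies above a minimal one, so a unique minimal upper bound is a
    least one. *)
Lemma joins_set2 D x y j : joins le D [set x; y] = [set j] <-> lub2 D x y j.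
Proof.
have set2_ub w : x ⊑ w -> y ⊑ w -> forall s, s \in [set x; y] -> s ⊑ w.
  by move=> xw yw s /set2P[] ->.
split=> [E|lj].
  have /joinsP[jD Sj jmin] : j \in joins le D [set x; y] by rewrite E set11.
  split; rewrite ?Sj ?set21 ?set22 // => w wD xw yw.
  have [k kJ kw] := exists_join_below wD (set2_ub _ xw yw).
  by move: kJ; rewrite E inE => /eqP <-.
have [jD xj yj jl] := lj; apply/setP=> k; rewrite inE; apply/joinsP/eqP => [[kD Sk kmin]|->].
  apply/esym/kmin => //; first exact: set2_ub.
  by apply: jl; rewrite ?Sk ?set21 ?set22.
split=> //; first exact: set2_ub.
by move=> w wD Sw wj; apply: le_asym => //; apply: jl; rewrite ?Sw ?set21 ?set22.
Qed.

Lemma jn_lub2 D x y j : lub2 D x y j -> jn le D x y = j.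
Proof.
move=> /joins_set2 E; rewrite /jn; case: pickP => [k|/(_ j)]; rewrite E inE //.
  by move/eqP.
by rewrite eqxx.
Qed.

End FinitePosets.

(** * Rank functions *)

Section RankedPosets.
Variables (T : finType) (le : rel T).
Hypotheses (le_refl : reflexive le) (le_anti : antisymmetric le).
Hypothesis le_trans : transitive le.
Implicit Types (P Q D S C : {set T}) (x y z w m : T).

Local Notation "x '⊑' y" := (le x y) (at level 70, no associativity).
Local Notation "x '⊏' y" := (lt le x y) (at level 70, no associativity).

Let anti := le_asym le_anti.

Lemma exists_maximal D x : x \in D ->
  exists m, [/\ m \in D, x ⊑ m & forall w, w \in D -> m ⊑ w -> w = m].
Proof.
apply: (@exists_minimal _ (fun x y => le y x)) => // [u v|u v w uv vw].
  by rewrite andbC => /le_anti.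
exact: le_trans vw uv.
Qed.

Lemma maxelP P m :
  reflect (m \in P /\ forall w, w \in P -> m ⊑ w -> w = m) (m \in maxel le P).
Proof.
rewrite inE; apply: (iffP andP) => -[mP mmax]; split=> //.
  move=> w wP mw; move/forallP/(_ w): mmax; rewrite wP /= /lt mw /= negbK.
  by move/eqP.
apply/forallP=> w; apply/implyP=> wP; rewrite /lt; apply/negP=> /andP[mw].
by rewrite (mmax w) ?eqxx.
Qed.

Lemma exists_maxel P x : x \in P -> exists2 m, m \in maxel le P & x ⊑ m.
Proof.
by move=> /exists_maximal[m [mP xm mmax]]; exists m => //; apply/maxelP.
Qed.

Definition least P z := z \in P /\ forall y, y \in P -> z ⊑ y.

Lemma least_botset P z : least P z -> botset le P = [set z].
Proof.
move=> [zP zl]; apply/setP=> w; rewrite !inE; apply/andP/eqP => [[wP]|->].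
  by move/forallP/(_ z); rewrite zP /= => wz; apply: anti => //; apply: zl.
by split=> //; apply/forallP=> y; apply/implyP; apply: zl.
Qed.

Lemma has_hat0P P : has_hat0 le P <-> exists z, least P z.
Proof.
split=> -[z]; last by move/least_botset; exists z.
move=> /setP/(_ z); rewrite !inE eqxx => /andP[zP /forallP zl]; exists z.
by split=> // y yP; have := zl y; rewrite yP.
Qed.

Lemma coversP P x y :
  reflect [/\ x \in P, y \in P, x ⊏ y & forall w, w \in P -> x ⊑ w -> w ⊏ y -> w = x]
          (covers le P x y).
Proof.
rewrite /covers; apply: (iffP and4P) => -[xP yP xy h]; split=> //.
  move=> w wP xw wy; move/forallP/(_ w): h; rewrite wP wy andbT /= /lt xw /= negbK.
  by move/eqP.
apply/forallP=> w; apply/implyP=> wP; apply/negP=> /andP[xw wy].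
by have := lt_neq xw; rewrite (h w) ?eqxx //; apply: ltW.
Qed.

Lemma covers_between P x y w :
  covers le P x y -> w \in P -> x ⊏ w -> w ⊑ y -> w = y.
Proof.
move=> /coversP[_ _ _ h] wP xw wy; case: (le_eqVlt wy) => // wy'.
by have := lt_neq xw; rewrite (h w) ?eqxx //; apply: ltW.
Qed.

Lemma exists_covers_below P x y : x \in P -> y \in P -> x ⊏ y ->
  exists2 w, x ⊑ w & covers le P w y.
Proof.
move=> xP yP xy.
have [|w [wD xw wmax]] := @exists_maximal [set w in P | (x ⊑ w) && (w ⊏ y)] x.
  by rewrite inE xP le_refl.
move: wD; rewrite inE => /and3P[wP _ wy]; exists w => //.
apply/coversP; split=> // v vP wv vy; apply: wmax => //.
by rewrite inE vP vy (le_trans xw wv).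
Qed.

Lemma exists_covers_above P x y : x \in P -> y \in P -> x ⊏ y ->
  exists2 w, covers le P x w & w ⊑ y.
Proof.
move=> xP yP xy.
have [|w [wD wy wmin]] :=
    @exists_minimal _ le le_refl le_anti le_trans [set w in P | (x ⊏ w) && (w ⊑ y)] y.
  by rewrite inE yP le_refl xy.
move: wD; rewrite inE => /and3P[wP xw _]; exists w => //.
apply/coversP; split=> // v vP xv vw.
case: (le_eqVlt xv) => // xv'.
have := lt_neq vw; rewrite (wmin v) ?eqxx //; last exact: ltW.
by rewrite inE vP xv' (le_trans (ltW vw) wy).
Qed.

(** A grading given by a local condition on covers. Exhibiting one yields both [ranked] and the
    values of [rk] through [rank_functionP], so that later arguments need not handle chains. *)
Definition rank_function P z (r : T -> nat) :=
  [/\ least P z, r z = 0 & forall x y, covers le P x y -> r y = (r x).+1].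

Lemma rank_function_lt P z r x y : rank_function P z r ->
  x \in P -> y \in P -> x ⊏ y -> r x < r y.
Proof.
move=> [_ _ rc] xP; move: y.
apply: (lt_ind le_refl le_anti le_trans) => y yP IH xy.
have [w xw wy] := exists_covers_below xP yP xy.
have /coversP[wP _ wly _] := wy.
rewrite (rc _ _ wy) ltnS; case: (le_eqVlt xw) => [->//|xw'].
exact/ltnW/IH.
Qed.

Lemma chainP C : reflect {in C &, forall x y, x ⊑ y \/ y ⊑ x} (chainb le C).
Proof.
apply: (iffP forallP) => [h x y xC yC|h x].
  by have := h x; rewrite xC => /forallP/(_ y); rewrite yC => /orP.
by apply/implyP=> xC; apply/forallP=> y; apply/implyP=> yC; apply/orP/h.
Qed.

Definition chain_below P x : pred {set T} :=
  [pred D : {set T} | (D \subset downset le P x) && chainb le D].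

Lemma chain_belowP P x C :
  reflect [/\ forall y, y \in C -> y \in P, forall y, y \in C -> y ⊑ x
            & {in C &, forall u v, u ⊑ v \/ v ⊑ u}] (chain_below P x C).
Proof.
apply: (iffP andP) => [[/subsetP sC /chainP ch]|[h1 h2 /chainP ch]]; last first.
  by split=> //; apply/subsetP=> y yC; rewrite inE h1 ?h2.
by split=> // y /sC; rewrite inE => /andP[].
Qed.

Lemma chain_below_setU1 P x y C : chain_below P x C -> y \in P -> y ⊑ x ->
  (forall w, w \in C -> w ⊑ y \/ y ⊑ w) -> chain_below P x (y |: C).
Proof.
move=> /chain_belowP[h1 h2 h3] yP yx hy; apply/chain_belowP; split.
- by move=> w /setU1P[->|/h1].
- by move=> w /setU1P[->|/h2].
move=> u v /setU1P[->|uC] /setU1P[->|vC]; try by [left|auto].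
by case: (hy v vC); auto.
Qed.

Lemma maxchain_setU1 P x y C : maxset (chain_below P x) C -> y \in P -> y ⊑ x ->
  (forall w, w \in C -> w ⊑ y \/ y ⊑ w) -> y \in C.
Proof.
move=> /maxsetP[ch mx] yP yx hy.
by rewrite -(mx _ (chain_below_setU1 ch yP yx hy)) ?setU11 ?subsetUr.
Qed.

Lemma maxchain_top P x C : maxset (chain_below P x) C -> x \in P -> x \in C.
Proof.
move=> mC xP; apply: (maxchain_setU1 mC) => // w wC; left.
by have /maxsetp/chain_belowP[_ h _] := mC; apply: h.
Qed.

(** Removing the top x from a maximal chain leaves a maximal chain below its new top w, and x covers
    w; hence induction along the order. The successor counts the bottom element. *)
Lemma card_maxchain P z r x C : rank_function P z r -> x \in P ->
  maxset (chain_below P x) C -> #|C| = (r x).+1.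
Proof.
move=> rf xP; have [[zP zl] rz rc] := rf.
move: x xP C; apply: (lt_ind le_refl le_anti le_trans) => x xP IH C mC.
have xC := maxchain_top mC xP.
have /chain_belowP[h1 h2 h3] := maxsetp mC.
have zC : z \in C.
  by apply: (maxchain_setU1 mC); rewrite ?zl // => w /h1 /zl; right.
case: (eqVneq z x) => [zx|nzx].
  suff -> : C = [set x] by rewrite cards1 -zx rz.
  apply/eqP; rewrite eqEsubset sub1set xC andbT; apply/subsetP=> w wC.
  by rewrite inE; apply/eqP/anti; rewrite ?h2 // -zx zl ?h1.
have [|w [wD _ wmax]] := @exists_maximal (C :\ x) z; first by rewrite !inE nzx.
have wtop v : v \in C :\ x -> v ⊑ w.
  move=> vD; have [_ vC] := setD1P vD; have [_ wC] := setD1P wD.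
  by case: (h3 v w vC wC) => // /(wmax v vD) ->.
case/setD1P: wD => nwx wC.
have wx : w ⊏ x by rewrite /lt h2 ?nwx.
have cwx : covers le P w x.
  apply/coversP; split; rewrite ?h1 // => v vP wv vx.
  apply: wmax => //; rewrite !inE (lt_neq vx) /=.
  apply: (maxchain_setU1 mC) (ltW vx) _ => // u uC.
  case: (eqVneq u x) => [->|nux]; first by right; apply: ltW.
  by left; apply: le_trans wv; apply: wtop; rewrite !inE nux.
have chD : chain_below P w (C :\ x).
  apply/chain_belowP; split=> // [y /setD1P[_ /h1]|u v /setD1P[_ uC] /setD1P[_ vC]] //.
  exact: h3.
rewrite (cardsD1 x C) xC add1n (rc _ _ cwx); congr _.+1; apply: IH => //; first exact: h1.
apply/maxsetP; split=> // B chB sB.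
have /chain_belowP[b1 b2 b3] := chB.
have nxB : x \notin B.
  by apply/negP=> /b2 xw; have := lt_neq wx; rewrite (anti xw (ltW wx)) eqxx.
have : x |: B = C.
  have /maxsetP[_ mx] := mC; apply: mx.
    apply: chain_below_setU1 => //.
      apply/chain_belowP; split=> // y /b2 yw; exact: le_trans yw (ltW wx).
    by move=> y /b2 yw; left; apply: le_trans yw (ltW wx).
  by rewrite -(setD1K xC) setUS.
by move=> <-; rewrite setU1K.
Qed.

Lemma hgt_maxchain P x : exists2 C, maxset (chain_below P x) C & hgt le P x = #|C|.
Proof.
have ch0 : chain_below P x set0.
  by apply/chain_belowP; split=> [y|y|u v]; rewrite inE.
have [|C chC hC] := @eq_bigmax_cond _ (mem (chain_below P x)) (fun C : {set T} => #|C|).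
  by apply/card_gt0P; exists set0.
exists C; last exact: hC.
apply/maxsetP; split=> // B chB sB; apply/esym/eqP; rewrite eqEcard sB -hC.
exact: (@leq_bigmax_cond _ (chain_below P x) (fun C : {set T} => #|C|)).
Qed.

Lemma rank_functionP P z r : rank_function P z r ->
  ranked le P /\ {in P, rk le P =1 r}.
Proof.
move=> rf; have hE x : x \in P -> hgt le P x = (r x).+1.
  by move=> xP; have [C mC ->] := hgt_maxchain P x; apply: (card_maxchain rf).
split=> [x xP C mC|x xP]; last by rewrite /rk hE.
by rewrite hE //; apply: (card_maxchain rf xP mC).
Qed.

Lemma rk_least P z : least P z -> rk le P z = 0.
Proof.
move=> [zP zl]; rewrite /rk; have [C /maxsetp/chain_belowP[h1 h2 _] ->] := hgt_maxchain P z.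
suff : #|C| <= 1 by case: #|C| => [|[]].
rewrite -(cards1 z); apply/subset_leq_card/subsetP=> y yC.
by rewrite inE; apply/eqP/anti; rewrite ?h2 ?zl ?h1.
Qed.

(** Adding y to a maximal chain below x gives a maximal chain below y, and [ranked] makes its size
    the height of y. *)
Lemma rk_covers P x y : ranked le P -> covers le P x y -> rk le P y = (rk le P x).+1.
Proof.
move=> rP cxy; have /coversP[xP yP xy _] := cxy.
have [C mC hC] := hgt_maxchain P x.
have xC := maxchain_top mC xP.
have /chain_belowP[h1 h2 h3] := maxsetp mC.
have nyC : y \notin C.
  by apply/negP=> /h2 yx; have := lt_neq xy; rewrite (anti yx (ltW xy)) eqxx.
suff /(rP _ yP) : maxset (chain_below P y) (y |: C).
  by rewrite /rk => <-; rewrite cardsU1 nyC hC /=; move: xC; rewrite (cardsD1 x) => ->.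
apply/maxsetP; split=> [|D chD sD].
  apply: chain_below_setU1 => //; last by move=> w /h2 wx; left; apply: le_trans wx (ltW xy).
  by apply/chain_belowP; split=> // w /h2 wx; apply: le_trans wx (ltW xy).
have /chain_belowP[d1 d2 d3] := chD.
have yD : y \in D by apply: (subsetP sD); rewrite setU11.
have xD : x \in D by apply: (subsetP sD); rewrite setU1r.
rewrite -(setD1K yD); congr (_ |: _).
have /maxsetP[_ mx] := mC; apply: mx; last first.
  apply/subsetP=> w wC; rewrite !inE (subsetP sD) ?setU1r // andbT.
  by apply: contraNneq nyC => <-.
apply/chain_belowP; split=> [w /setD1P[_ /d1]|w /setD1P[nwy wD]|
                              u v /setD1P[_ uD] /setD1P[_ vD]] //.
  case: (d3 w x wD xD) => // xw; case: (le_eqVlt xw) => [->//|xw'].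
  by move: nwy; rewrite (covers_between cxy (d1 _ wD) xw' (d2 _ wD)) eqxx.
exact: d3.
Qed.

Lemma rank_function_rk P z : least P z -> ranked le P -> rank_function P z (rk le P).
Proof. by move=> lz rP; split=> //; [apply: rk_least | move=> x y; apply: rk_covers]. Qed.

Definition glb2 D x y g :=
  [/\ g \in D, g ⊑ x, g ⊑ y & forall w, w \in D -> w ⊑ x -> w ⊑ y -> w ⊑ g].

Let ge_anti : antisymmetric (fun x y => le y x).
Proof. by move=> u v; rewrite andbC => /le_anti. Qed.

Let ge_trans : transitive (fun x y => le y x).
Proof. by move=> u v w uv vw; apply: le_trans vw uv. Qed.

Lemma meets_set2 D x y g : meets le D [set x; y] = [set g] <-> glb2 D x y g.
Proof. exact: (@joins_set2 _ (fun u v => le v u) le_refl ge_anti ge_trans D x y g). Qed.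

Lemma mt_glb2 D x y g : glb2 D x y g -> mt le D x y = g.
Proof. exact: (@jn_lub2 _ (fun u v => le v u) le_refl ge_anti ge_trans D x y g). Qed.

Lemma geometricP D : geometric le D <->
  (forall x y, x \in D -> y \in D ->
     (exists j, lub2 le D x y j) /\ (exists g, glb2 D x y g)) /\
  (forall x y, x \in D -> y \in D ->
     covers le D x y <->
     exists2 a, a \in atoms le D & ~~ (a ⊑ x) /\ lub2 le D x a y).
Proof.
have jE := joins_set2 le_refl le_anti le_trans.
split=> -[lat cov]; split=> x y xD yD.
- have [[j /jE lj] [g /meets_set2 gg]] := lat x y xD yD.
  by split; [exists j | exists g].
- split=> [/(cov _ _ xD yD)|] [a aA [nax /jE h]]; first by exists a.
  by apply/(cov _ _ xD yD); exists a.
- have [[j /jE lj] [g /meets_set2 gg]] := lat x y xD yD.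
  by split; [exists j | exists g].
split=> [/(cov _ _ xD yD)|] [a aA [nax /jE h]]; first by exists a.
by apply/(cov _ _ xD yD); exists a.
Qed.

(** * Order ideals *)

Section Ideals.
Variables (P : {set T}) (z : T).
Hypotheses (Pz : least P z) (P_ranked : ranked le P).

Lemma downset_ideal m : order_ideal le P (downset le P m).
Proof.
split=> [|x y xP]; first by apply/subsetP=> x; rewrite inE => /andP[].
by rewrite !inE xP => /andP[_ ym] xy; apply: le_trans xy ym.
Qed.

Lemma mem_downset m x : x \in downset le P m = (x \in P) && (x ⊑ m).
Proof. by rewrite inE. Qed.

Lemma downset_of_ideal Q m : order_ideal le P Q -> m \in Q ->
  downset le Q m = downset le P m.
Proof.
move=> [/subsetP sQP idQ] mQ; apply/setP=> x; rewrite !inE.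
by apply/andP/andP => -[h xm]; split=> //; [apply: sQP | apply: idQ xm].
Qed.

Lemma least_in_ideal Q y : order_ideal le P Q -> y \in Q -> z \in Q.
Proof.
case: Pz => zP zl [/subsetP sQP idQ] yQ.
by apply: (idQ z y zP yQ); apply/zl/sQP.
Qed.

Lemma least_ideal Q : order_ideal le P Q -> z \in Q -> least Q z.
Proof.
by case: Pz => zP zl [/subsetP sQP idQ] zQ; split=> // y /sQP; apply: zl.
Qed.

Lemma covers_ideal Q x y : order_ideal le P Q -> y \in Q ->
  covers le Q x y = covers le P x y.
Proof.
move=> [/subsetP sQP idQ] yQ; apply/coversP/coversP => -[xP _ xy h]; split=> //.
- exact: sQP.
- exact: sQP.
- by move=> w wP xw wy; apply: h => //; apply: (idQ w y) => //; apply: ltW.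
- by apply: (idQ x y) => //; apply: ltW.
by move=> w wQ; apply/h/sQP.
Qed.

Lemma rank_function_ideal Q : order_ideal le P Q -> z \in Q ->
  rank_function Q z (rk le P).
Proof.
move=> idQ zQ; split; first exact: least_ideal.
  exact: rk_least.
move=> x y cxy; apply: rk_covers => //; rewrite -(covers_ideal x idQ) //.
by case/coversP: cxy.
Qed.

Lemma ranked_ideal Q : order_ideal le P Q -> z \in Q -> ranked le Q.
Proof. by move=> idQ zQ; case: (rank_functionP (rank_function_ideal idQ zQ)). Qed.

Lemma rk_ideal Q : order_ideal le P Q -> {in Q, rk le Q =1 rk le P}.
Proof.
move=> idQ x xQ; have zQ := least_in_ideal idQ xQ.
by case: (rank_functionP (rank_function_ideal idQ zQ)) => _; apply.
Qed.

Lemma atoms_ideal Q a : order_ideal le P Q ->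
  (a \in atoms le Q) = (a \in Q) && (a \in atoms le P).
Proof.
move=> idQ; rewrite !inE; case aQ: (a \in Q) => //=.
by rewrite rk_ideal //; case: idQ => /subsetP -> .
Qed.

Lemma rk_lt x y : x \in P -> y \in P -> x ⊏ y -> rk le P x < rk le P y.
Proof. exact: rank_function_lt (rank_function_rk Pz P_ranked). Qed.

Lemma atomsP a : reflect (covers le P z a) (a \in atoms le P).
Proof.
have rz := rk_least Pz; have [zP zl] := Pz.
rewrite inE; apply: (iffP andP) => [[aP /eqP ra]|cza]; last first.
  by rewrite (rk_covers P_ranked cza) rz; case/coversP: cza.
have za : z ⊏ a.
  by rewrite /lt zl //; apply: contra_eqN ra; rewrite eq_sym => /eqP ->; rewrite rz.
have [w cw wa] := exists_covers_above zP aP za.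
case: (le_eqVlt wa) => [<-//|wa'].
have /coversP[_ wP _ _] := cw.
by have := rk_lt wP aP wa'; rewrite (rk_covers P_ranked cw) ra rz.
Qed.

Lemma le_atom a x : a \in atoms le P -> x \in P -> x ⊑ a -> x = z \/ x = a.
Proof.
move=> /atomsP ca xP xa; have /coversP[_ _ _ h] := ca; have [_ zl] := Pz.
by case: (le_eqVlt xa) => [|xa']; [right | left; apply: h; rewrite ?zl].
Qed.

Hypothesis P_lg : locally_geometric le P.

Lemma lg_lub m x y : m \in P -> x \in P -> y \in P -> x ⊑ m -> y ⊑ m ->
  exists j, lub2 le (downset le P m) x y j.
Proof.
move=> mP xP yP xm ym; have /geometricP[lat _] := P_lg mP.
by have [] := lat x y; rewrite ?mem_downset ?xP ?yP.
Qed.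

Lemma lg_glb m x y : m \in P -> x \in P -> y \in P -> x ⊑ m -> y ⊑ m ->
  exists g, glb2 (downset le P m) x y g.
Proof.
move=> mP xP yP xm ym; have /geometricP[lat _] := P_lg mP.
by have [] := lat x y; rewrite ?mem_downset ?xP ?yP.
Qed.

Lemma lg_covers_atom x y : covers le P x y ->
  exists a, [/\ a \in atoms le P, ~~ (a ⊑ x) & a ⊑ y].
Proof.
move=> cxy; have /coversP[xP yP xy _] := cxy; have /geometricP[_ cov] := P_lg yP.
have yD : y \in downset le P y by rewrite mem_downset yP le_refl.
have xD : x \in downset le P y by rewrite mem_downset xP (ltW xy).
have [+ _] := cov x y xD yD; rewrite (covers_ideal x (downset_ideal y)) // => /(_ cxy).
case=> a; rewrite (atoms_ideal _ (downset_ideal y)) mem_downset.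
move=> /andP[/andP[_ ay] aA] [nax _].
by exists a.
Qed.

Lemma lg_atom_covers m x a y : m \in P -> x \in P -> y \in P -> a \in atoms le P ->
  y ⊑ m -> ~~ (a ⊑ x) -> lub2 le (downset le P m) x a y -> covers le P x y.
Proof.
move=> mP xP yP aA ym nax ly; have [yD xy ay _] := ly.
have /geometricP[_ cov] := P_lg mP.
have xD : x \in downset le P m by rewrite mem_downset xP (le_trans xy ym).
rewrite -(covers_ideal x (downset_ideal m)) //; apply/(cov x y xD yD); exists a => //.
rewrite (atoms_ideal _ (downset_ideal m)) aA andbT mem_downset (le_trans ay ym) andbT.
by case/atomsP/coversP: aA.
Qed.

Lemma lg_ideal Q : order_ideal le P Q -> locally_geometric le Q.
Proof.
move=> idQ x xQ; rewrite (downset_of_ideal idQ) //; apply: P_lg.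
by case: idQ => /subsetP -> .
Qed.

End Ideals.

(** * The Moebius function *)

Section Moebius.
Local Open Scope ring_scope.

Definition strict_downset P x : {set T} := [set w in P | w ⊏ x].

Lemma strict_downset_proper P w x : w \in P -> w ⊏ x ->
  (#|strict_downset P w| < #|strict_downset P x|)%N.
Proof.
move=> wP wx; apply/proper_card/properP; split.
  apply/subsetP=> v; rewrite !inE => /andP[-> vw] /=.
  exact: lt_le_trans (ltW wx).
by exists w; rewrite !inE wP ?wx //= lt_irr.
Qed.

Lemma mu_recS P n z x : x != z -> z ⊑ x ->
  mu_rec le P n.+1 z x = - \sum_(w in P | (z ⊑ w) && (w ⊏ x)) mu_rec le P n z w.
Proof. by move=> nxz zx; rewrite /= eq_sym (negbTE nxz) zx. Qed.

(** Each recursive call moves to a strictly smaller element, so the number of elements strictly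
    below x is enough fuel. With fuel 0 nothing lies strictly below x, which forces x = z. *)
Lemma mu_rec_fuel P z n k x : least P z -> x \in P ->
  (#|strict_downset P x| <= n)%N -> (#|strict_downset P x| <= k)%N ->
  mu_rec le P n z x = mu_rec le P k z x.
Proof.
move=> [zP zl]; elim: n k x => [|n IH] [|k] x xP //.
- move=> le0 _ /=; case: eqVneq => // nzx; rewrite zl //.
  move: le0; rewrite leqn0 cards_eq0 => /eqP/setP/(_ z).
  by rewrite !inE zP /lt zl //= nzx.
- move=> _ le0 /=; case: eqVneq => // nzx; rewrite zl //.
  move: le0; rewrite leqn0 cards_eq0 => /eqP/setP/(_ z).
  by rewrite !inE zP /lt zl //= nzx.
move=> len lem; case: (eqVneq x z) => [->|nxz]; first by rewrite /= eqxx.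
rewrite !mu_recS ?zl //; congr (- _); apply: eq_bigr => w /and3P[wP _ wx].
by apply: IH => //; rewrite -ltnS (leq_trans (strict_downset_proper wP wx)).
Qed.

Lemma sum_downset P x (F : T -> int) : x \in P ->
  \sum_(w in P | w ⊑ x) F w = F x + \sum_(w in P | w ⊏ x) F w.
Proof.
move=> xP; rewrite (bigD1 x) /= ?xP ?le_refl //; congr (_ + _).
by apply: eq_bigl => w; rewrite -andbA.
Qed.

Lemma mu_sum P z x : least P z -> x \in P ->
  \sum_(w in P | w ⊑ x) mu le P z w = (x == z)%:R.
Proof.
move=> lz xP; have [zP zl] := lz; rewrite sum_downset // /mu.
have [n En] : exists n, #|P| = n.+1.
  by move: xP; rewrite (cardsD1 x) => ->; rewrite add1n; eexists.
case: (eqVneq x z) => [->|nxz].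
  rewrite big1 => [|w /andP[wP wz]]; first by rewrite En /= eqxx addr0.
  by have := lt_irr le z; rewrite (le_lt_trans le_anti le_trans (zl w wP) wz).
rewrite En mu_recS ?zl // addrC; apply/eqP; rewrite subr_eq0; apply/eqP.
apply: eq_big => [w|w /andP[wP wx]].
  by case wP: (w \in P) => //=; rewrite zl.
(* Unfolding [mu] at x leaves one unit of fuel less than #|P|. This still suffices for w, which has
   strictly fewer predecessors than x. *)
have lew : (#|strict_downset P w| <= n)%N.
  rewrite -ltnS -En; apply: leq_trans (strict_downset_proper wP wx) _.
  by apply/subset_leq_card/subsetP=> v; rewrite inE => /andP[].
by apply: mu_rec_fuel; rewrite // (leq_trans lew).
Qed.

(** This allows a Moebius function to be guessed and then verified by its sums over downsets, as is
    done with [ext_mu]. *)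
Lemma mu_unique P z (nu : T -> int) : least P z ->
  (forall x, x \in P -> \sum_(w in P | w ⊑ x) nu w = (x == z)%:R) ->
  {in P, mu le P z =1 nu}.
Proof.
move=> lz nuE; apply: (lt_ind le_refl le_anti le_trans) => x xP IH.
have := mu_sum lz xP; rewrite -nuE // !sum_downset // => E.
apply: (addIr (\sum_(w in P | w ⊏ x) nu w)); rewrite -E; congr (_ + _).
by apply: eq_bigr => w /andP[wP wx]; rewrite IH.
Qed.

Lemma charpoly_least P z : least P z ->
  charpoly le P = \sum_(x in P) (mu le P z x)%:P * 'X^(rkP le P - rk le P x).
Proof. by move=> lz; rewrite /charpoly (least_botset lz) big_set1. Qed.

End Moebius.

(** * Invariance under isomorphism *)

(** All posets live in the same type [T], so an isomorphism is a self-map of [T] restricted to P,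
    with image [f @: P]. Injectivity on P follows from antisymmetry. *)
Definition embedding P (f : T -> T) := {in P &, forall x y, (f x ⊑ f y) = (x ⊑ y)}.

Lemma embeddingS P D f : D \subset P -> embedding P f -> embedding D f.
Proof. by move=> /subsetP sDP fE x y /sDP xP /sDP yP; apply: fE. Qed.

Lemma deletion_sub P a : deletion le P a \subset P.
Proof.
apply/subsetP=> x; rewrite in_setU => /orP[|/bigcupP[S _ /joinsP[]]] //.
by rewrite inE => /andP[].
Qed.

Lemma restriction_sub P a : restriction le P a \subset P.
Proof. by apply/subsetP=> x; rewrite inE => /andP[]. Qed.

Section Embedding.
Variables (P : {set T}) (f : T -> T).
Hypothesis fE : embedding P f.

Lemma emb_inj : {in P &, injective f}.
Proof.
by move=> x y xP yP fxy; apply: anti; rewrite -fE // fxy le_refl.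
Qed.

Lemma emb_lt : {in P &, forall x y, (f x ⊏ f y) = (x ⊏ y)}.
Proof. by move=> x y xP yP; rewrite /lt fE // (inj_in_eq emb_inj). Qed.

Lemma mem_emb (D : {set T}) x : D \subset P -> x \in P -> (f x \in f @: D) = (x \in D).
Proof.
move=> /subsetP sDP xP; apply/imsetP/idP => [[y yD /emb_inj ->]|xD] //; last by exists x.
exact: sDP.
Qed.

Lemma emb_downset x : x \in P -> downset le (f @: P) (f x) = f @: downset le P x.
Proof.
move=> xP; apply/setP=> y; rewrite inE.
apply/andP/imsetP => [[/imsetP[w wP ->] wx]|[w]].
  by exists w; rewrite // inE wP -fE.
by rewrite inE => /andP[wP wx] ->; rewrite imset_f ?fE.
Qed.

Lemma emb_upset x : x \in P -> upset le (f @: P) (f x) = f @: upset le P x.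
Proof.
move=> xP; apply/setP=> y; rewrite inE.
apply/andP/imsetP => [[/imsetP[w wP ->] wx]|[w]].
  by exists w; rewrite // inE wP -fE.
by rewrite inE => /andP[wP wx] ->; rewrite imset_f ?fE.
Qed.

Lemma emb_mem_joins (S : {set T}) j : S \subset P -> j \in P ->
  (f j \in joins le (f @: P) (f @: S)) = (j \in joins le P S).
Proof.
move=> /subsetP sSP jP; have fS w : w \in P ->
    (forall s, s \in f @: S -> s ⊑ f w) <-> (forall s, s \in S -> s ⊑ w).
  move=> wP; split=> Sw s; last by move=> /imsetP[u uS ->]; rewrite (fE (sSP u uS) wP) Sw.
  by move=> sS; rewrite -(fE (sSP s sS) wP) Sw ?imset_f.
apply/joinsP/joinsP => -[_ Sj jmin]; split; rewrite ?imset_f //.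
- exact/(fS j jP).
- move=> w wP Sw wj; apply: emb_inj => //; apply: jmin; rewrite ?imset_f ?fE //.
  exact/(fS w wP).
- exact/(fS j jP).
move=> _ /imsetP[w wP ->] /(fS w wP) Sw; rewrite fE // => wj; congr f; exact: jmin.
Qed.

Lemma emb_least z : least P z -> least (f @: P) (f z).
Proof.
move=> [zP zl]; split; first exact: imset_f.
by move=> _ /imsetP[y yP ->]; rewrite fE ?zl.
Qed.

Lemma emb_covers : {in P &, forall x y, covers le (f @: P) (f x) (f y) = covers le P x y}.
Proof.
move=> x y xP yP; apply/coversP/coversP => -[_ _ xy h]; split; rewrite ?imset_f ?emb_lt //.
- by rewrite -emb_lt.
- by move=> w wP xw wy; apply: emb_inj => //; apply: h; rewrite ?imset_f ?fE ?emb_lt.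
by move=> _ /imsetP[w wP ->]; rewrite fE ?emb_lt // => xw wy; congr f; apply: h.
Qed.

Lemma emb_poset_ok : poset_ok le P ->
  poset_ok le (f @: P) /\ {in P, forall x, rk le (f @: P) (f x) = rk le P x}.
Proof.
(* The maximum runs over a fibre with a single element for y in the image, so [r] transports the
   rank without an inverse of [f]. *)
move=> [/has_hat0P[z lz] rP]; pose r y := \max_(x in P | f x == y) rk le P x.
have rE x : x \in P -> r (f x) = rk le P x.
  move=> xP; rewrite /r (big_pred1 x) // => y; apply/andP/eqP => [[yP /eqP]|->//].
  exact: emb_inj.
have rf : rank_function (f @: P) (f z) r.
  have [zP _] := lz; split; rewrite ?rE ?rk_least //; first exact: emb_least.
  move=> u v cuv; have /coversP[/imsetP[x xP ux] /imsetP[y yP vy] _ _] := cuv.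
  move: cuv; rewrite {}ux {}vy emb_covers // !rE //; exact: rk_covers.
have [rP2 rkE] := rank_functionP rf; split; first split=> //.
  by apply/has_hat0P; exists (f z); apply: emb_least.
by move=> x xP; rewrite rkE ?rE ?imset_f.
Qed.

Lemma emb_atoms : poset_ok le P -> atoms le (f @: P) = f @: atoms le P.
Proof.
move=> /emb_poset_ok[_ rkE]; apply/setP=> y; rewrite inE.
apply/andP/imsetP => [[/imsetP[x xP ->]]|[x]].
  by rewrite rkE // => rx; exists x; rewrite // inE xP.
by rewrite inE => /andP[xP rx] ->; rewrite imset_f ?rkE.
Qed.

Lemma emb_lub2 : {in P & &, forall x y j,
  lub2 le P x y j -> lub2 le (f @: P) (f x) (f y) (f j)}.
Proof.
move=> x y j xP yP jP [_ xj yj jl]; split; rewrite ?imset_f ?fE //.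
by move=> _ /imsetP[w wP ->]; rewrite !fE //; apply: jl.
Qed.

Lemma emb_lub2_inv : {in P & &, forall x y j,
  lub2 le (f @: P) (f x) (f y) (f j) -> lub2 le P x y j}.
Proof.
move=> x y j xP yP jP [_ xj yj jl]; split=> //; try by rewrite -fE.
by move=> w wP xw yw; rewrite -fE // jl ?imset_f ?fE.
Qed.

Lemma emb_glb2 : {in P & &, forall x y g,
  glb2 P x y g -> glb2 (f @: P) (f x) (f y) (f g)}.
Proof.
move=> x y g xP yP gP [_ gx gy gl]; split; rewrite ?imset_f ?fE //.
by move=> _ /imsetP[w wP ->]; rewrite !fE //; apply: gl.
Qed.

Lemma emb_geometric : poset_ok le P -> geometric le P -> geometric le (f @: P).
Proof.
move=> Pok /geometricP[lat cov]; apply/geometricP.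
split=> _ _ /imsetP[x xP ->] /imsetP[y yP ->].
  have [[j lj] [g gg]] := lat x y xP yP; split.
    by exists (f j); apply: emb_lub2 => //; case: lj.
  by exists (f g); apply: emb_glb2 => //; case: gg.
rewrite emb_covers //; split=> [/(cov x y xP yP)|] [a].
  move=> aA [nax lj]; have aP : a \in P by move: aA; rewrite inE => /andP[].
  by exists (f a); [rewrite emb_atoms // imset_f | rewrite fE //; split=> //; apply: emb_lub2].
rewrite emb_atoms // => /imsetP[c cA ->] [ncx lj]; apply/(cov x y xP yP).
have cP : c \in P by move: cA; rewrite inE => /andP[].
by exists c; rewrite // -fE //; split=> //; apply: emb_lub2_inv.
Qed.

Lemma emb_deletion a : poset_ok le P -> a \in P ->
  deletion le (f @: P) (f a) = f @: deletion le P a.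
Proof.
move=> Pok aP; have [/has_hat0P[z lz] _] := Pok.
have atP : atoms le P \subset P by apply/subsetP=> x; rewrite inE => /andP[].
rewrite /deletion /sub_atoms (least_botset lz) (least_botset (emb_least lz)).
rewrite imsetU imset_set1 emb_atoms //; congr (_ :|: _); apply/setP=> y.
apply/bigcupP/imsetP => [[S /andP[/subsetP sS S0] yS]|[x /bigcupP[S /andP[sS S0] xS] ->]].
  have SE : S = f @: [set x in P | f x \in S].
    apply/setP=> w; apply/idP/imsetP => [wS|[x]]; last by rewrite inE => /andP[_ xS] ->.
    have /setD1P[_ /imsetP[x xA wx]] := sS _ wS.
    by exists x; rewrite // inE (subsetP atP) // -wx.
  have /joinsP[/imsetP[x xP yx] _ _] := yS.
  exists x => //; apply/bigcupP; exists [set w in P | f w \in S]; last first.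
    rewrite -emb_mem_joins // -?SE -?yx //; by apply/subsetP=> w; rewrite inE => /andP[].
  apply/andP; split; last by apply: contraNneq S0 => S0; rewrite SE S0 imset0.
  apply/subsetP=> w /setIdP[wP /sS /setD1P[nwa fw]].
  move: fw; rewrite mem_emb // => wA; rewrite in_setD1 wA andbT.
  by apply: contraNneq nwa => ->.
have sSP : S \subset P by apply: subset_trans sS _; apply: subset_trans (subD1set _ _) atP.
have /joinsP[xP _ _] := xS.
exists (f @: S); last by rewrite emb_mem_joins.
rewrite imset_eq0 S0 andbT; apply/subsetP=> _ /imsetP[w wS ->].
have /setD1P[nwa wA] := subsetP sS _ wS.
rewrite in_setD1 mem_emb ?(subsetP atP) // wA andbT.
by rewrite (inj_in_eq emb_inj (subsetP sSP w wS) aP).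
Qed.

Lemma emb_mu_rec n :
  {in P &, forall x y, mu_rec le (f @: P) n (f x) (f y) = mu_rec le P n x y}.
Proof.
elim: n => [|n IH] x y xP yP /=; rewrite (inj_in_eq emb_inj) // fE //.
case: ifP => // _; case: ifP => // _; congr (- _)%R.
rewrite big_mkcondr big_imset /=; last exact: emb_inj.
rewrite [RHS]big_mkcondr /=; apply: eq_bigr => w wP.
by rewrite fE // emb_lt // IH.
Qed.

Lemma emb_charpoly : poset_ok le P -> charpoly le (f @: P) = charpoly le P.
Proof.
move=> Pok; have [[/has_hat0P[z lz] _] [_ rkE]] := (Pok, emb_poset_ok Pok).
have rkPE : rkP le (f @: P) = rkP le P.
  by rewrite /rkP big_imset /=; [apply: eq_bigr => x /rkE | apply: emb_inj].
rewrite (charpoly_least lz) (charpoly_least (emb_least lz)) rkPE.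
rewrite big_imset /=; last exact: emb_inj.
apply: eq_bigr => x xP; rewrite rkE // /mu card_in_imset; last exact: emb_inj.
by rewrite emb_mu_rec //; case: lz.
Qed.

End Embedding.

Lemma inductive_poset_ok P : inductive_poset le P -> poset_ok le P.
Proof.
case=> // z; have lz : least [set z] z by split=> [|y]; rewrite inE // => /eqP ->.
have [] // := @rank_functionP [set z] z (fun=> 0).
  split=> // x y /coversP[/set1P-> /set1P-> ].
  by rewrite (negbTE (lt_irr le z)).
by split=> //; apply/has_hat0P; exists z.
Qed.

(** Induction on the derivation: the deletion and restriction of the image are the images, under the
    same map, of the deletion and restriction. *)
Lemma emb_inductive P f : inductive_poset le P -> embedding P f ->
  inductive_poset le (f @: P).
Proof.
elim=> {P} [z|P a Pok Plg aA R_ind IHR D_ind IHD dvd] fE.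
  by rewrite imset_set1; constructor.
have aP : a \in P by move: aA; rewrite inE => /andP[].
have fR := embeddingS (restriction_sub P a) fE.
have fD := embeddingS (deletion_sub P a) fE.
have dE := emb_deletion fE Pok aP; have rE := emb_upset fE aP.
apply: (@ind_step _ _ _ (f a)); rewrite ?dE /restriction ?rE; try by [apply: IHR | apply: IHD].
- by case: (emb_poset_ok fE Pok).
- move=> _ /imsetP[m mP ->]; rewrite emb_downset //.
  have [/has_hat0P[z lz] rP] := Pok.
  have idm := downset_ideal P m; have mD : m \in downset le P m by rewrite inE mP le_refl.
  apply: emb_geometric; last exact: Plg.
    by apply: embeddingS fE; case: idm.
  have zD := least_in_ideal lz idm mD.
  split; last exact: (ranked_ideal lz rP idm zD).
  by apply/has_hat0P; exists z; apply: (least_ideal lz idm zD).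
- by rewrite emb_atoms // imset_f.
rewrite !emb_charpoly //; exact: inductive_poset_ok.
Qed.

(** * Extensions of an ideal by atoms *)

(* Abstracts what is needed of a TM-ideal Q of corank one in P: A is the set of atoms
   outside Q, p the projection to Q, and f b y the join of b and y. *)
Record extension P Q (A : {set T}) (p : T -> T) (f : T -> T -> T) : Prop := Extension {
  ext_ideal : order_ideal le P Q;
  ext_disj : forall b, b \in A -> b \in P /\ b \notin Q;
  ext_proj : forall x, x \in P ->
    [/\ p x \in Q, p x ⊑ x & forall q, q \in Q -> q ⊑ x -> q ⊑ p x];
  ext_lub : forall b y, b \in A -> y \in Q -> lub2 le P b y (f b y);
  ext_liftK : forall b y, b \in A -> y \in Q -> p (f b y) = y;
  ext_projK : forall b x, b \in A -> x \in P -> b ⊑ x -> f b (p x) = x;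
  ext_new : forall x, x \in P -> x \notin Q -> exists2 b, b \in A & b ⊑ x }.

Section Extension.
Variables (P Q A : {set T}) (z : T) (p : T -> T) (f : T -> T -> T).
Hypotheses (Pz : least P z) (P_ranked : ranked le P) (P_lg : locally_geometric le P).
Hypotheses (zQ : z \in Q) (E : extension P Q A p f).

Lemma ext_sub x : x \in Q -> x \in P.
Proof. by case: (ext_ideal E) => /subsetP h _; apply: h. Qed.

Lemma ext_down x y : x \in P -> y \in Q -> x ⊑ y -> x \in Q.
Proof. by case: (ext_ideal E) => _; apply. Qed.

Lemma ext_above_new b x : b \in A -> b ⊑ x -> x \notin Q.
Proof.
by move=> /(ext_disj E)[bP nbQ] bx; apply: contra nbQ => xQ; apply: ext_down bx.
Qed.

Lemma proj_in x : x \in P -> p x \in Q. Proof. by case/(ext_proj E). Qed.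

Lemma proj_le x : x \in P -> p x ⊑ x. Proof. by case/(ext_proj E). Qed.

Lemma proj_max x q : x \in P -> q \in Q -> q ⊑ x -> q ⊑ p x.
Proof. by case/(ext_proj E)=> _ _; apply. Qed.

Lemma proj_id x : x \in Q -> p x = x.
Proof.
by move=> xQ; have xP := ext_sub xQ; apply: anti; [apply: proj_le | apply: proj_max].
Qed.

Lemma proj_mono x y : x \in P -> y \in P -> x ⊑ y -> p x ⊑ p y.
Proof.
move=> xP yP xy; apply: proj_max => //; first exact: proj_in.
exact: le_trans (proj_le xP) xy.
Qed.

Lemma lift_in b y : b \in A -> y \in Q -> f b y \in P.
Proof. by move=> bA /(ext_lub E bA)[]. Qed.

Lemma lift_base b y : b \in A -> y \in Q -> b ⊑ f b y.
Proof. by move=> bA /(ext_lub E bA)[]. Qed.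

Lemma lift_ge b y : b \in A -> y \in Q -> y ⊑ f b y.
Proof. by move=> bA /(ext_lub E bA)[]. Qed.

Lemma lift_new b y : b \in A -> y \in Q -> f b y \notin Q.
Proof. by move=> bA yQ; apply: (ext_above_new bA); apply: lift_base. Qed.

(** The lift reflects the order because its left inverse [p] is monotone, and preserves it because f
    b x is a least upper bound. *)
Lemma lift_leE b x y : b \in A -> x \in Q -> y \in Q -> (f b x ⊑ f b y) = (x ⊑ y).
Proof.
move=> bA xQ yQ; apply/idP/idP => xy.
  by rewrite -(ext_liftK E bA xQ) -(ext_liftK E bA yQ) proj_mono ?lift_in.
have [_ _ _] := ext_lub E bA xQ; apply; rewrite ?lift_in ?lift_base //.
exact: le_trans xy (lift_ge bA yQ).
Qed.

(** Let p x <= w < x. If w is in Q, it is at most p x. Otherwise w lies above a new atom b and p w =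
    p x, so w = f b (p w) = f b (p x) = x, a contradiction. *)
Lemma proj_covers x : x \in P -> x \notin Q -> covers le P (p x) x.
Proof.
move=> xP nxQ; have pQ := proj_in xP; apply/coversP; split=> //.
- exact: ext_sub.
- by rewrite /lt proj_le //; apply: contraNneq nxQ => <-.
move=> w wP pw wx; case wQ: (w \in Q); first by apply: anti pw; apply: proj_max (ltW wx).
have [b bA bw] := ext_new E wP (negbT wQ).
have pwx : p w = p x.
  apply: anti; first exact: proj_mono (ltW wx).
  exact: proj_max.
have := lt_neq wx; rewrite -(ext_projK E bA wP bw) pwx.
by rewrite (ext_projK E bA xP (le_trans bw (ltW wx))) eqxx.
Qed.

Lemma ext_base b : b \in A -> p b = z /\ f b z = b.
Proof.
move=> bA; have [bP _] := ext_disj E bA; have [_ zl] := Pz.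
have fz : f b z = b.
  apply: anti; last exact: lift_base.
  by have [_ _ _] := ext_lub E bA zQ; apply; rewrite ?zl.
by split=> //; rewrite -[in p b]fz (ext_liftK E).
Qed.

Lemma ext_atom b : b \in A -> b \in atoms le P.
Proof.
move=> bA; have [bP nbQ] := ext_disj E bA; apply/(atomsP Pz P_ranked).
by have [<- _] := ext_base bA; apply: proj_covers.
Qed.

Lemma atom_notin a : a \in atoms le P -> a \notin Q -> a \in A.
Proof.
move=> aA naQ; have aP : a \in P by case/(atomsP Pz P_ranked)/coversP: aA.
have [b bA ba] := ext_new E aP naQ; have [bP nbQ] := ext_disj E bA.
case: (le_atom Pz P_ranked aA bP ba) => eb; last by rewrite -eb.
by rewrite eb zQ in nbQ.
Qed.

(** Together with [lift_leE] this makes the restriction at b a copy of Q. *)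
Lemma ext_upset b : b \in A -> upset le P b = f b @: Q.
Proof.
move=> bA; apply/setP=> x; rewrite inE; apply/andP/imsetP => [[xP bx]|[y yQ ->]].
  by exists (p x); rewrite ?proj_in ?(ext_projK E).
by rewrite lift_in ?lift_base.
Qed.

(** * Deleting one of the new atoms *)

Section Deletion.
Variable a : T.
Hypothesis aA : a \in A.

(* An explicit description of the deletion of [a]; see [deletion_trimmed]. *)
Definition trimmed : {set T} := Q :|: [set x in P | [exists b in A :\ a, b ⊑ x]].

Local Notation P' := trimmed.

Lemma trimmedP x :
  reflect (x \in P /\ (x \in Q \/ exists2 b, b \in A :\ a & b ⊑ x)) (x \in P').
Proof.
rewrite !inE; apply: (iffP orP) => [[xQ|/andP[xP /exists_inP h]]|[xP [xQ|h]]].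
- by split; [apply: ext_sub | left].
- by split; [|right].
- by left.
by right; rewrite xP; apply/exists_inP.
Qed.

Lemma trimmed_sub x : x \in P' -> x \in P. Proof. by case/trimmedP. Qed.

Lemma trimmed_up x y : x \in P' -> x \notin Q -> y \in P -> x ⊑ y -> y \in P'.
Proof.
case/trimmedP=> _ [-> //|[b bA bx]] _ yP xy; apply/trimmedP; split=> //.
by right; exists b => //; apply: le_trans bx xy.
Qed.

Lemma trimmedQ x : x \in Q -> x \in P'. Proof. by rewrite !inE => ->. Qed.

Lemma trimmed_new x : x \in P' -> x \notin Q -> exists2 b, b \in A :\ a & b ⊑ x.
Proof. by case/trimmedP=> _ [->|]. Qed.

Lemma trimmed_least : least P' z.
Proof. by case: Pz => _ zl; split=> [|y /trimmed_sub]; [apply: trimmedQ | apply: zl]. Qed.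

(** The hypothesis of the induction on the number of new atoms: every clause is inherited with [p]
    and [f] unchanged. *)
Lemma trimmed_extension : extension P' Q (A :\ a) p f.
Proof.
split.
- split=> [|x y /trimmed_sub xP]; last exact: ext_down.
  by apply/subsetP=> x; apply: trimmedQ.
- move=> b bA'; have [_ bA] := setD1P bA'; have [bP nbQ] := ext_disj E bA; split=> //.
  by apply/trimmedP; split=> //; right; exists b.
- by move=> x /trimmed_sub; apply: (ext_proj E).
- move=> b y bA' yQ; have [_ bA] := setD1P bA'.
  have [fP bf yf fl] := ext_lub E bA yQ; split=> //.
    by apply/trimmedP; split=> //; right; exists b.
  by move=> w /trimmed_sub; apply: fl.
- by move=> b y /setD1P[_]; apply: (ext_liftK E).
- by move=> b x /setD1P[_ bA] /trimmed_sub; apply: (ext_projK E).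
exact: trimmed_new.
Qed.

(** Suppose some w outside P' lies strictly between x and y. Then x is in Q, since P' minus Q is
    upward closed in P, and y is not, since w is not. As nothing in P' lies strictly between x and
    y, p y = x; but y covers p y in P. *)
Lemma trimmed_covers x y : x \in P' -> y \in P' -> covers le P' x y = covers le P x y.
Proof.
move=> xP' yP'; have xP := trimmed_sub xP'; have yP := trimmed_sub yP'.
apply/coversP/coversP => -[_ _ xy h]; split=> // w; last by move=> /trimmed_sub; apply: h.
move=> wP xw wy; case wP': (w \in P'); first exact: h.
have [nwQ nwb] : w \notin Q /\ forall b, b \in A :\ a -> ~~ (b ⊑ w).
  split=> [|b bA]; first by apply: contraFN wP' => /trimmedQ.
  by apply: contraFN wP' => bw; apply/trimmedP; split=> //; right; exists b.
have xQ : x \in Q.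
  apply: contraFT wP' => nxQ; exact: trimmed_up xw.
have nyQ : y \notin Q by apply: contra nwQ => yQ; apply: ext_down (ltW wy).
have pyx : p y = x.
  apply: h; first exact/trimmedQ/proj_in.
    exact: proj_max (le_trans xw (ltW wy)).
  by rewrite /lt proj_le //; apply: contraNneq nyQ => <-; apply: proj_in.
have /coversP[_ _ _] := proj_covers yP nyQ; rewrite pyx.
by apply.
Qed.

Lemma trimmed_rank_function : rank_function P' z (rk le P).
Proof.
split; [exact: trimmed_least | exact: rk_least | move=> x y cxy].
have /coversP[xP' yP' _ _] := cxy.
by apply: rk_covers; rewrite // -trimmed_covers.
Qed.

Lemma trimmed_ranked : ranked le P'.
Proof. by case: (rank_functionP trimmed_rank_function). Qed.

Lemma trimmed_rk : {in P', rk le P' =1 rk le P}.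
Proof. by case: (rank_functionP trimmed_rank_function). Qed.

Lemma trimmed_atoms x : (x \in atoms le P') = (x \in P') && (x \in atoms le P).
Proof.
have aE D : (x \in atoms le D) = (x \in D) && (rk le D x == 1) by rewrite inE.
rewrite !aE; case xP': (x \in P') => //=.
by rewrite trimmed_rk // (trimmed_sub xP').
Qed.

Lemma base_notin_trimmed : a \notin P'.
Proof.
have [aP naQ] := ext_disj E aA.
apply/negP=> /trimmed_new/(_ naQ)[b /setD1P[nba bA] ba].
have [bP nbQ] := ext_disj E bA.
case: (le_atom Pz P_ranked (ext_atom aA) bP ba) => eb; last by rewrite eb eqxx in nba.
by rewrite eb zQ in nbQ.
Qed.

(** The join never leaves P': above an element of P' outside Q everything is in P', and if x and y
    are both in Q then p j is already an upper bound, so j = p j. *)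
Lemma trimmed_lub m x y j : m \in P' -> x \in P' -> y \in P' ->
  lub2 le (downset le P m) x y j -> lub2 le (downset le P' m) x y j.
Proof.
move=> mP' xP' yP' [+ xj yj jl]; rewrite mem_downset => /andP[jP jm].
have jP' : j \in P'.
  case xQ: (x \in Q); last exact: trimmed_up (negbT xQ) jP xj.
  case yQ: (y \in Q); last exact: trimmed_up (negbT yQ) jP yj.
  have pjP := ext_sub (proj_in jP).
  have pjm := le_trans (proj_le jP) jm.
  apply: trimmedQ; rewrite (_ : j = p j) ?proj_in //; apply: anti; last exact: proj_le.
  by apply: jl; rewrite ?mem_downset ?pjP ?pjm ?proj_max.
split=> //; first by rewrite mem_downset jP'.
move=> w; rewrite mem_downset => /andP[/trimmed_sub wP wm].
by apply: jl; rewrite mem_downset wP.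
Qed.

(** The meet in P can be lost by the deletion, and its projection then replaces it: a lower bound in
    P' outside Q would force g into P', so all of them are in Q and hence below p g. *)
Lemma trimmed_glb m x y g : m \in P' ->
  glb2 (downset le P m) x y g -> exists g', glb2 (downset le P' m) x y g'.
Proof.
move=> mP' [+ gx gy gl]; rewrite mem_downset => /andP[gP gm].
have gl' w : w \in downset le P' m -> w ⊑ x -> w ⊑ y -> w ⊑ g.
  rewrite mem_downset => /andP[/trimmed_sub wP wm].
  by apply: gl; rewrite mem_downset wP.
case gP': (g \in P'); first by exists g; split; rewrite ?mem_downset ?gP'.
have pgg := proj_le gP; exists (p g); split.
- by rewrite mem_downset trimmedQ ?proj_in // (le_trans pgg gm).
- exact: le_trans gx.
- exact: le_trans gy.
move=> w wD wx wy; have wg := gl' w wD wx wy.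
move: wD; rewrite mem_downset => /andP[wP' _].
case wQ: (w \in Q); first exact: proj_max.
by rewrite (trimmed_up wP' (negbT wQ) gP wg) in gP'.
Qed.

(** The atom supplied by P may be the deleted one. If x is in Q, any remaining new atom below y
    replaces it. Otherwise x and y share a new atom, so x != y forces p x < p y, and an atom of Q
    below p y but not below p x is also not below x. *)
Lemma trimmed_covers_atom x y : x \in P' -> y \in P' -> covers le P x y ->
  exists c, [/\ c \in P', c \in atoms le P, ~~ (c ⊑ x) & c ⊑ y].
Proof.
move=> xP' yP' cxy; have /coversP[xP yP xy _] := cxy.
have [a0 [a0A na0x a0y]] := lg_covers_atom Pz P_ranked P_lg cxy.
have a0P : a0 \in P by case/(atomsP Pz P_ranked)/coversP: a0A.
case a0P' : (a0 \in P'); first by exists a0.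
have na0Q : a0 \notin Q by apply: contraFN a0P' => /trimmedQ.
have nyQ : y \notin Q by apply: contra na0Q => yQ; apply: ext_down a0y.
case xQ: (x \in Q).
  have [b bA' b_y] := trimmed_new yP' nyQ; have [nba bA] := setD1P bA'.
  exists b; split=> //; [|exact: ext_atom|].
    apply/trimmedP; split; [by case: (ext_disj E bA) | by right; exists b].
  by apply: contraL xQ => bx; apply: ext_above_new bx.
have [b /setD1P[_ bA] bx] := trimmed_new xP' (negbT xQ).
have pxy : p x ⊏ p y.
  rewrite /lt (proj_mono xP yP (ltW xy)); apply: contraTneq (xy) => pxy.
  have b_y := le_trans bx (ltW xy).
  by rewrite -(ext_projK E bA xP bx) pxy (ext_projK E bA yP b_y) lt_irr.
have [v cv vy] := exists_covers_above (ext_sub (proj_in xP)) (ext_sub (proj_in yP)) pxy.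
have [c [cA ncx cv']] := lg_covers_atom Pz P_ranked P_lg cv.
have cP : c \in P by case/(atomsP Pz P_ranked)/coversP: cA.
have cQ : c \in Q by apply: (ext_down cP (proj_in yP)); apply: le_trans vy.
exists c; split=> //; first exact: trimmedQ.
  by apply: contra ncx => cx; apply: proj_max.
exact: le_trans cv' (le_trans vy (proj_le yP)).
Qed.

(** Joins below m and covers agree with those of P, so the only new input is an atom of P' for each
    cover. *)
Lemma trimmed_lg : locally_geometric le P'.
Proof.
move=> m mP'; have mP := trimmed_sub mP'; apply/geometricP.
have idm := downset_ideal P' m; have P'z := trimmed_least.
have dn x : x \in downset le P' m -> x \in P' /\ x ⊑ m.
  by rewrite mem_downset => /andP.
have lub x y : x \in downset le P' m -> y \in downset le P' m ->
    exists j, lub2 le (downset le P m) x y j.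
  by move=> /dn[/trimmed_sub xP xm] /dn[/trimmed_sub yP ym]; apply: lg_lub.
split=> x y xD yD; have [[xP' xm] [yP' ym]] := (dn x xD, dn y yD).
  split.
    by have [j lj] := lub x y xD yD; exists j; apply: trimmed_lub lj.
  have [g gg] := lg_glb P_lg mP (trimmed_sub xP') (trimmed_sub yP') xm ym.
  exact: trimmed_glb gg.
rewrite (covers_ideal x idm) // trimmed_covers //; split=> [cxy|[c]].
  have [c [cP' cA ncx cy]] := trimmed_covers_atom xP' yP' cxy.
  have cD : c \in downset le P' m by rewrite mem_downset cP' (le_trans cy ym).
  exists c; first by rewrite (atoms_ideal P'z trimmed_ranked) // cD trimmed_atoms cP'.
  split=> //; have [j lj] := lub x c xD cD.
  have lj' := trimmed_lub mP' xP' cP' lj.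
  suff <- : j = y by [].
  have [_ xj cj jl] := lj'; have jy : j ⊑ y by apply: jl => //; case/coversP: cxy => _ _ /ltW.
  have [+ _ _ _] := lj; rewrite mem_downset => /andP[jP _].
  apply: (covers_between cxy) => //; rewrite /lt xj.
  by apply: contraNneq ncx => ->.
rewrite (atoms_ideal P'z trimmed_ranked) // trimmed_atoms => /and3P[cD cP' cA] [ncx ly].
have [j lj] := lub x c xD cD.
have <- := lub2_uniq le_anti (trimmed_lub mP' xP' cP' lj) ly.
have [+ _ _ _] := lj; rewrite mem_downset => /andP[jP jm].
apply: (lg_atom_covers Pz P_ranked P_lg mP (trimmed_sub xP') jP cA jm ncx lj).
Qed.

(** A join of atoms of Q equals its own projection by minimality; any other join lies above a new
    atom other than a. Conversely x is a join of all atoms other than a below it. A smaller upper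
    bound would lie below some v covered by x: if v is in P', [trimmed_covers_atom] gives an atom
    that v misses; if not, x is outside Q, and a remaining new atom below x is also below v, putting
    v in P'. *)
Lemma deletion_trimmed : deletion le P a = P'.
Proof.
have atP c : c \in atoms le P -> c \in P by case/(atomsP Pz P_ranked)/coversP.
apply/setP=> x; rewrite /deletion /sub_atoms (least_botset Pz) in_setU in_set1.
apply/orP/idP => [[/eqP ->|/bigcupP[S /andP[/subsetP sS _] /joinsP[xP Sx xmin]]]|xP'].
- exact: trimmedQ.
- case: (boolP (S \subset Q)) => [/subsetP SQ|/subsetPn[s sIS nsQ]].
    apply: trimmedQ; rewrite (_ : x = p x) ?proj_in //; apply/esym/xmin.
    + exact/ext_sub/proj_in.
    + by move=> s sIS; apply: proj_max; rewrite ?SQ ?Sx.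
    exact: proj_le.
  have /setD1P[nsa sA] := sS _ sIS; apply/trimmedP; split=> //; right; exists s.
    by rewrite !inE nsa atom_notin.
  exact: Sx.
have xP := trimmed_sub xP'; case: (eqVneq x z) => [|nxz]; [by left | right].
pose S := [set s in atoms le P :\ a | s ⊑ x].
have SP s : s \in P' -> s \in atoms le P -> s ⊑ x -> s \in S.
  move=> sP' sA sx; rewrite !inE sx andbT atP //= (_ : s != a).
    by move: sA; rewrite inE => /andP[].
  by apply: contraTneq sP' => ->; apply: base_notin_trimmed.
have joinS w : w \in P -> (forall s, s \in S -> s ⊑ w) -> w ⊑ x -> w = x.
  move=> wP Sw wx; case: (le_eqVlt wx) => // wltx.
  have [v wv cv] := exists_covers_below wP xP wltx.
  have /coversP[vP _ vx _] := cv.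
  case vP' : (v \in P').
    have [c [cP' cA ncv cx]] := trimmed_covers_atom vP' xP' cv.
    by case/negP: ncv; apply: le_trans wv; apply/Sw/SP.
  have nvQ : v \notin Q by apply: contraFN vP' => /trimmedQ.
  have nxQ : x \notin Q by apply: contra nvQ => xQ; apply: ext_down (ltW vx).
  have [b bA' bx] := trimmed_new xP' nxQ; have [nba bA] := setD1P bA'.
  case/negP: vP'; apply/trimmedP; split=> //; right; exists b => //.
  apply: le_trans wv; apply: Sw; apply: SP => //; last exact: ext_atom.
  by apply/trimmedP; split; [case: (ext_disj E bA) | right; exists b].
apply/bigcupP; exists S.
  apply/andP; split; first by apply/subsetP=> s; rewrite inE => /andP[].
  apply: contraNneq nxz => S0; apply/eqP/esym/joinS.
  - by case: Pz.
  - by move=> s; rewrite S0 inE.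
  by case: Pz => _; apply.
by apply/joinsP; split=> // s; rewrite inE => /andP[].
Qed.

End Deletion.

(** * Moebius function and characteristic polynomial of an extension *)

Section CharacteristicPolynomial.
Local Open Scope ring_scope.

Let Qz : least Q z. Proof. exact: (least_ideal Pz (ext_ideal E) zQ). Qed.

Lemma sum_lift (R : zmodType) (K : pred T) (F : T -> R) b : b \in A ->
  \sum_(x in P | (b ⊑ x) && K x) F x = \sum_(y in Q | K (f b y)) F (f b y).
Proof.
move=> bA; rewrite (reindex_onto (f b) p) /=; last first.
  by move=> x /and3P[xP bx _]; apply: (ext_projK E).
apply: eq_bigl => y; case yQ: (y \in Q).
  by rewrite lift_in // lift_base // (ext_liftK E) // eqxx andbT.
by apply: contraFF yQ => /andP[/andP[fP _] /eqP <-]; apply: proj_in.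
Qed.

(** The number of new atoms below x is left as a sum over them, ready to be exchanged with a sum
    over elements. *)
Definition ext_mu x : int :=
  if x \in Q then mu le Q z x else - \sum_(b in A | b ⊑ x) mu le Q z (p x).

(** The part over Q is the Moebius sum at p x, namely [p x = z]. After exchanging sums, each new
    atom b <= x contributes minus the same value, since f b y <= x amounts to y <= p x. For x in Q
    there is no such b; for x outside Q with p x = z, x itself is the only one and the two parts
    cancel. *)
Lemma ext_mu_sum x : x \in P -> \sum_(w in P | w ⊑ x) ext_mu w = (x == z)%:R.
Proof.
move=> xP; rewrite (bigID (mem Q)) /=.
have -> : \sum_(w | (w \in P) && (w ⊑ x) && (w \in Q)) ext_mu w = (p x == z)%:R.
  rewrite -(mu_sum Qz (proj_in xP)); apply: eq_big => [w|w /andP[_ wQ]];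
    last by rewrite /ext_mu wQ.
  case wQ: (w \in Q); rewrite ?andbF // andbT ext_sub //=.
  by apply/idP/idP=> [|wp]; [apply: proj_max | apply: le_trans (proj_le xP)].
have -> : \sum_(w | (w \in P) && (w ⊑ x) && (w \notin Q)) ext_mu w
          = - \sum_(b in A | b ⊑ x) (p x == z)%:R.
  transitivity (- \sum_(w in P | w ⊑ x) \sum_(b in A | b ⊑ w) mu le Q z (p w)).
    rewrite [in RHS](bigID (mem Q)) /= [X in - (X + _)]big1 ?add0r => [|w /andP[_ wQ]];
      last first.
      by apply: big1 => b /andP[bA bw]; case/negP: (ext_above_new bA bw).
    rewrite -sumrN; apply: eq_bigr => w /andP[_ wQ].
    by rewrite /ext_mu (negbTE wQ).
  congr (- _); rewrite (exchange_big_dep (mem A)) /=; last by move=> w b _ /andP[].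
  rewrite [RHS]big_mkcondr /=; apply: eq_bigr => b bA.
  transitivity (\sum_(w in P | (b ⊑ w) && (w ⊑ x)) mu le Q z (p w)).
    by apply: eq_bigl => w; rewrite bA /= -andbA; congr (_ && _); rewrite andbC.
  rewrite sum_lift //; case: ifP => bx.
    rewrite -(mu_sum Qz (proj_in xP)); apply: eq_big => [y|y /andP[yQ _]].
      by case yQ: (y \in Q) => //=; rewrite -{1}(ext_projK E bA xP bx) lift_leE ?proj_in.
    by rewrite (ext_liftK E).
  rewrite big1 // => y /andP[yQ fx]; move: bx.
  by rewrite (le_trans (lift_base bA yQ) fx).
case xQ: (x \in Q).
  rewrite proj_id // big1 ?subr0 // => b /andP[bA bx].
  by move: xQ; rewrite (negbTE (ext_above_new bA bx)).
have -> : (x == z) = false by apply: contraFF xQ => /eqP ->.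
case: (eqVneq (p x) z) => [pxz|npz]; last by rewrite big1 ?subr0.
have [b bA bx] := ext_new E xP (negbT xQ).
have xb c : c \in A -> c ⊑ x -> x = c.
  by move=> cA cx; rewrite -(ext_projK E cA xP cx) pxz; case: (ext_base cA).
rewrite (big_pred1 b) ?subrr // => c /=.
apply/andP/eqP => [[cA cx]|->//]; by rewrite -(xb c cA cx) -(xb b bA bx).
Qed.

Lemma ext_rk_new x : x \in P -> x \notin Q -> rk le P x = (rk le Q (p x)).+1.
Proof.
move=> xP nxQ; rewrite (rk_covers P_ranked (proj_covers xP nxQ)).
by rewrite (rk_ideal Pz P_ranked (ext_ideal E)) ?proj_in.
Qed.

Lemma ext_rk_lift b y : b \in A -> y \in Q -> rk le P (f b y) = (rk le Q y).+1.
Proof.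
by move=> bA yQ; rewrite ext_rk_new ?lift_in ?lift_new // (ext_liftK E).
Qed.

Lemma rk_leq_rkP D x : x \in D -> (rk le D x <= rkP le D)%N.
Proof. exact: (@leq_bigmax_cond _ (mem D) (rk le D)). Qed.

Lemma ext_rkP : A != set0 -> rkP le P = (rkP le Q).+1.
Proof.
move=> /set0Pn[b bA]; apply/eqP; rewrite eqn_leq; apply/andP; split.
  apply/bigmax_leqP=> x xP; case xQ: (x \in Q).
    by rewrite -(rk_ideal Pz P_ranked (ext_ideal E)) // leqW // rk_leq_rkP.
  by rewrite ext_rk_new ?xQ // ltnS rk_leq_rkP // proj_in.
have [|y yQ Ey] := @eq_bigmax_cond _ (mem Q) (rk le Q); first by apply/card_gt0P; exists z.
by rewrite /rkP Ey -(ext_rk_lift bA yQ) rk_leq_rkP // lift_in.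
Qed.

(** The elements of Q give 'X times the polynomial of Q, because the total rank grows by one; this
    needs a new atom. Each copy of Q above a new atom contributes minus that polynomial, the two
    rank shifts cancelling. *)
Lemma ext_charpoly : A != set0 ->
  charpoly le P = ('X - #|A|%:R) * charpoly le Q.
Proof.
move=> nA; rewrite (charpoly_least Pz) (charpoly_least Qz) (ext_rkP nA).
have muE := mu_unique Pz ext_mu_sum.
rewrite (bigID (mem Q)) /= mulrBl; congr (_ + _).
  rewrite mulr_sumr; apply: eq_big => [x|x /andP[xP xQ]].
    by case xQ: (x \in Q); rewrite ?andbF // ext_sub.
  rewrite muE // /ext_mu xQ -(rk_ideal Pz P_ranked (ext_ideal E)) //.
  by rewrite subSn ?rk_leq_rkP // exprS mulrCA.
transitivity (- \sum_(x in P) \sum_(b in A | b ⊑ x)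
    (mu le Q z (p x))%:P * 'X^(rkP le Q - rk le Q (p x))).
  rewrite [in RHS](bigID (mem Q)) /= [X in - (X + _)]big1 ?add0r => [|x /andP[_ xQ]];
    last first.
    by apply: big1 => b /andP[bA bx]; case/negP: (ext_above_new bA bx).
  rewrite -sumrN; apply: eq_bigr => x /andP[xP xQ].
  rewrite muE // /ext_mu (negbTE xQ) ext_rk_new // subSS polyCN mulNr rmorph_sum /=.
  by rewrite mulr_suml.
congr (- _); rewrite (exchange_big_dep (mem A)) /=; last by move=> x b _ /andP[].
rewrite mulr_natl -sumr_const; apply: eq_bigr => b bA.
transitivity (\sum_(x in P | (b ⊑ x) && predT x)
    (mu le Q z (p x))%:P * 'X^(rkP le Q - rk le Q (p x))).
  by apply: eq_bigl => x; rewrite bA andbT.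
rewrite sum_lift //; apply: eq_big => [y|y /andP[yQ _]]; first by rewrite andbT.
by rewrite (ext_liftK E).
Qed.

End CharacteristicPolynomial.
End Extension.

Lemma extension_set0 P Q p f : extension P Q set0 p f -> P = Q.
Proof.
move=> E; apply/eqP; rewrite eq_sym eqEsubset; case: (ext_ideal E) => -> _ /=.
apply/subsetP=> x xP; case xQ: (x \in Q) => //.
by have [b] := ext_new E xP (negbT xQ); rewrite inE.
Qed.

Lemma extension_inductive P Q (A : {set T}) z p f :
  least P z -> ranked le P -> locally_geometric le P -> z \in Q ->
  extension P Q A p f -> inductive_poset le Q -> inductive_poset le P.
Proof.
move=> + + + zQ + Q_ind; have [n] := ubnP #|A|.
elim: n A P => // n IH A P leAn Pz P_ranked P_lg E.
case: (set_0Vmem A) => [A0|[a aA]].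
  by rewrite A0 in E; rewrite (extension_set0 E).
have cardA : #|A :\ a| < n.
  by move: leAn; rewrite (cardsD1 a) aA add1n ltnS.
have E' := trimmed_extension E a.
have fE : embedding Q (f a).
  by move=> x y xQ yQ; apply: (lift_leE E).
apply: (@ind_step _ _ _ a).
- by split=> //; apply/has_hat0P; exists z.
- exact: P_lg.
- exact: (ext_atom Pz P_ranked zQ E).
- by rewrite /restriction (ext_upset E aA); apply: emb_inductive.
- rewrite (deletion_trimmed Pz P_ranked P_lg zQ E aA); apply: IH E' => //.
  + exact: (trimmed_least Pz zQ E).
  + exact: (trimmed_ranked Pz P_ranked zQ E).
  exact: (trimmed_lg Pz P_ranked P_lg zQ E).
rewrite (deletion_trimmed Pz P_ranked P_lg zQ E aA) /restriction (ext_upset E aA).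
rewrite (emb_charpoly fE); last exact: inductive_poset_ok.
(* If a was the last new atom, the deletion is Q itself and the rank drops, so the quotient is 1 and
   not 'X - 0. *)
case: (eqVneq (A :\ a) set0) => [A0|nA].
  by rewrite A0 in E'; rewrite (extension_set0 E'); exists 1%R; rewrite mul1r.
exists ('X - #|A :\ a|%:R)%R.
apply: (ext_charpoly _ _ zQ E' nA); first exact: (trimmed_least Pz zQ E).
exact: (trimmed_ranked Pz P_ranked zQ E).
Qed.

(** * TM-ideals are extensions *)

Section TMIdeals.
Variables (P Q : {set T}) (z : T).
Hypotheses (Pz : least P z) (P_ranked : ranked le P) (P_lg : locally_geometric le P).
Hypotheses (zQ : z \in Q) (TM : TM_ideal le P Q) (rk_bound : rkP le P <= (rkP le Q).+1).

Let idQ : order_ideal le P Q. Proof. by case: TM. Qed.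
Let QP x : x \in Q -> x \in P. Proof. by case: idQ => /subsetP h _; apply: h. Qed.
Let Q_down x y : x \in P -> y \in Q -> x ⊑ y -> x \in Q.
Proof. by case: idQ => _; apply. Qed.

(** For q in Q below M, the join of q and m below M is a minimal upper bound in all of P, hence in Q
    by join-closure; maximality of m makes it equal to m. *)
Lemma ideal_top M : M \in maxel le P -> exists2 m, m \in maxel le Q &
  [/\ m ⊑ M, modular_el le (downset le P M) m & forall q, q \in Q -> q ⊑ M -> q ⊑ m].
Proof.
case: TM => _ _ Qjc _ Qmod MP; have [m mQ mM] := Qmod M MP; exists m => //.
have [mD _] := mM; have [mQ' mmax] := maxelP _ _ mQ; have [MP' _] := maxelP _ _ MP.
move: mD; rewrite mem_downset => /andP[mP mleM]; split=> // q qQ qM.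
have [j [+ qj mj jl]] := lg_lub P_lg MP' (QP qQ) mP qM mleM.
rewrite mem_downset => /andP[jP jM].
suff jQ : j \in Q by rewrite -(mmax j jQ mj).
have sS : [set q; m] \subset Q by apply/subsetP=> _ /set2P[] ->.
apply: (subsetP (Qjc _ sS)); apply/joinsP; split=> // [_ /set2P[]->//|w wP Sw wj].
apply: anti (wj) _; apply: jl; rewrite ?mem_downset ?wP ?Sw ?set21 ?set22 //.
exact: le_trans wj jM.
Qed.

Definition ideal_proj x : T :=
  odflt x [pick q in Q | (q ⊑ x) && [forall r in Q, (r ⊑ x) ==> (r ⊑ q)]].

Local Notation p := ideal_proj.

(** The largest element of Q below x is the meet of x with the top m of Q below some maximal M >= x.
    The default value in [ideal_proj] is therefore never taken on P. *)
Lemma ideal_projP x : x \in P ->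
  [/\ p x \in Q, p x ⊑ x & forall q, q \in Q -> q ⊑ x -> q ⊑ p x].
Proof.
move=> xP; rewrite /p; case: pickP => [q /and3P[qQ qx /forallP ql] /=|none].
  by split=> // r rQ rx; have := ql r; rewrite rQ rx.
have [M MP xM] := exists_maxel xP; have [m mQ [mM _ mtop]] := ideal_top MP.
have [mQ' _] := maxelP _ _ mQ; have [MP' _] := maxelP _ _ MP.
have [g [+ gm gx gl]] := lg_glb P_lg MP' (QP mQ') xP mM xM.
rewrite mem_downset => /andP[gP gM]; have gQ := Q_down gP mQ' gm.
have := none g; rewrite gQ gx => /negP[]; apply/forallP=> r.
apply/implyP=> rQ; apply/implyP=> rx; have rM := le_trans rx xM.
by apply: gl; rewrite ?mem_downset ?QP ?mtop.
Qed.

(** The modular law for m, once meeting with m is recognised as the projection on elements below M.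
    It applies to v because v <= m. *)
Lemma ideal_proj_lub M u v j : M \in maxel le P -> u \in P -> u ⊑ M ->
  v \in Q -> lub2 le (downset le P M) u v j ->
  lub2 le (downset le P M) (p u) v (p j).
Proof.
move=> MP uP uM vQ lj; have [MP' _] := maxelP _ _ MP.
have [m mQ [mM [mD mod] mtop]] := ideal_top MP; have [mQ' _] := maxelP _ _ mQ.
have mtE x : x \in P -> x ⊑ M -> mt le (downset le P M) m x = p x.
  move=> xP xM; have [pQ px pl] := ideal_projP xP; have pM := le_trans px xM.
  apply: mt_glb2; split; rewrite ?mem_downset ?(QP pQ) ?pM ?mtop // => w.
  rewrite mem_downset => /andP[wP _] wm wx; apply: pl => //; exact: Q_down wm.
have [+ uj vj _] := lj; rewrite mem_downset => /andP[jP jM].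
have vM := le_trans vj jM; have vm := mtop v vQ vM.
have := mod u v; rewrite !mem_downset uP uM QP // vM vm => /(_ isT isT isT).
rewrite (jn_lub2 le_refl le_anti le_trans lj) !mtE // => ->.
have [pQ px _] := ideal_projP uP.
have [k lk] := lg_lub P_lg MP' (QP pQ) (QP vQ) (le_trans px uM) vM.
by rewrite (jn_lub2 le_refl le_anti le_trans lk).
Qed.

Lemma rk_maxel m : m \in maxel le Q -> rk le P m = rkP le Q.
Proof.
move=> mQ; have [mQ' _] := maxelP _ _ mQ; case: TM => _ Qpure _ _ _.
have [|y yQ Ey] := @eq_bigmax_cond _ (mem Q) (rk le Q); first by apply/card_gt0P; exists z.
have [m' m'Q ym'] := exists_maxel yQ; have [m'Q' _] := maxelP _ _ m'Q.
rewrite -(rk_ideal Pz P_ranked idQ) // (Qpure m m' mQ m'Q).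
apply/eqP; rewrite eqn_leq rk_leq_rkP // [rkP _ _]Ey.
rewrite !(rk_ideal Pz P_ranked idQ) //=; case: (le_eqVlt ym') => [->//|lt_ym'].
by apply/ltnW/(rk_lt Pz P_ranked); rewrite ?QP.
Qed.

(* Modularity makes v |-> join(x, v) strictly increasing on the elements of Q between
   p x and the top modular element, so the rank can drop by at most one. *)
Lemma rk_ideal_proj x : x \in P -> rk le P x <= (rk le P (p x)).+1.
Proof.
move=> xP; have [M MP xM] := exists_maxel xP; have [MP' _] := maxelP _ _ MP.
have [m mQ [mM _ mtop]] := ideal_top MP; have [mQ' _] := maxelP _ _ mQ.
have [pQ px pl] := ideal_projP xP; have pM := le_trans px xM.
have rk_le u v : u \in P -> v \in P -> u ⊑ v -> rk le P u <= rk le P v.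
  by move=> uP vP /le_eqVlt[->//|uv]; apply/ltnW/(rk_lt Pz P_ranked).
(* Passing from p x to v raises the rank at most as much as passing from x to the join j of x and
   v. *)
have step v : v \in Q -> p x ⊑ v -> v ⊑ M ->
    forall j, lub2 le (downset le P M) x v j ->
    rk le P x + rk le P v <= rk le P j + rk le P (p x).
  move: v; apply: (lt_ind le_refl le_anti le_trans) => v vQ IH pv vM j lj.
  have [+ xj vj jl] := lj; rewrite mem_downset => /andP[jP jM].
  case: (le_eqVlt pv) => [<-|pv']; first by rewrite leq_add2r rk_le.
  have [w pw cwv] := exists_covers_below pQ vQ pv'.
  have /coversP[wQ _ wv _] := cwv; have wM := le_trans (ltW wv) vM.
  have [i li] := lg_lub P_lg MP' xP (QP wQ) xM wM.
  have [+ xi wi il] := li; rewrite mem_downset => /andP[iP iM].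
  have pj := ideal_proj_lub MP xP xM vQ lj.
  have pi := ideal_proj_lub MP xP xM wQ li.
  have lub_le u : u \in Q -> p x ⊑ u -> u ⊑ M -> lub2 le (downset le P M) (p x) u u.
    by move=> uQ pu uM; split; rewrite // mem_downset (QP uQ).
  (* The joins of x with v and with w project back to v and w, so they are distinct. *)
  have pjE := lub2_uniq le_anti pj (lub_le v vQ pv vM).
  have piE := lub2_uniq le_anti pi (lub_le w wQ pw wM).
  have ij : i ⊏ j.
    rewrite /lt il ?mem_downset ?jP ?(le_trans (ltW wv) vj) //=.
    by apply: contraNneq (lt_neq wv) => ij; rewrite -piE -pjE ij.
  have := IH w wQ wv pw wM i li.
  have := rk_lt Pz P_ranked iP jP ij.
  rewrite (covers_ideal w idQ vQ) in cwv; rewrite (rk_covers P_ranked cwv) addnS.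
  by move=> ltij le_i; apply: leq_ltn_trans le_i _; rewrite ltn_add2r.
have [j lj] := lg_lub P_lg MP' xP (QP mQ') xM mM.
have [+ _ _ _] := lj; rewrite mem_downset => /andP[jP _].
(* At v = m the rank of v is rk Q, while that of j is at most rk Q + 1. *)
have := step m mQ' (mtop _ pQ pM) mM j lj; rewrite (rk_maxel mQ) => le1.
have := leq_trans (rk_leq_rkP jP) rk_bound => le2.
rewrite -(leq_add2r (rkP le Q)); apply: leq_trans le1 _.
by rewrite addSn -addnS addnC leq_add2l.
Qed.

Lemma ideal_proj_covers x : x \in P -> x \notin Q -> covers le P (p x) x.
Proof.
move=> xP nxQ; have [pQ px _] := ideal_projP xP; apply/coversP; split=> //; first exact: QP.
  by rewrite /lt px; apply: contraNneq nxQ => <-.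
move=> w wP pw wx; case: (le_eqVlt pw) => // pw'.
have := leq_ltn_trans (rk_lt Pz P_ranked (QP pQ) wP pw') (rk_lt Pz P_ranked wP xP wx).
by rewrite ltnNge rk_ideal_proj.
Qed.

(** Descend through elements outside Q. When x covers some w in Q, an atom c below x but not below w
    must be outside Q: otherwise x, a minimal upper bound of w and c, would be in Q by
    join-closure. *)
Lemma exists_new_atom x : x \in P -> x \notin Q -> exists2 b, b \in atoms le P :\: Q & b ⊑ x.
Proof.
move: x; apply: (lt_ind le_refl le_anti le_trans) => x xP IH nxQ.
have [zP zl] := Pz.
have zx : z ⊏ x by rewrite /lt zl //; apply: contraNneq nxQ => <-.
have [w _ cwx] := exists_covers_below zP xP zx; have /coversP[wP _ wx _] := cwx.
case wQ: (w \in Q); last first.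
  have [b bA bw] := IH w wP wx (negbT wQ); exists b => //; exact: le_trans bw (ltW wx).
have [c [cA ncw cx]] := lg_covers_atom Pz P_ranked P_lg cwx.
exists c => //; rewrite inE cA andbT; apply: contra nxQ => cQ.
case: TM => _ _ Qjc _ _.
have sS : [set w; c] \subset Q by apply/subsetP=> _ /set2P[] ->.
apply: (subsetP (Qjc _ sS)); apply/joinsP; split=> // [_ /set2P[]->//|y yP Sy yx].
  exact: ltW.
apply: (covers_between cwx) => //; rewrite /lt Sy ?set21 //.
by apply: contraNneq ncw => ->; rewrite Sy ?set22.
Qed.

Lemma TM_extension : extension P Q (atoms le P :\: Q) p (jn le P).
Proof.
have newP b : b \in atoms le P :\: Q -> [/\ b \in P, b \notin Q & b \in atoms le P].
  by move=> /setDP[bA nbQ]; split=> //; case/(atomsP Pz P_ranked)/coversP: bA.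
have jnP b y : b \in atoms le P :\: Q -> y \in Q -> lub2 le P b y (jn le P b y).
  move=> /newP[bP nbQ bA] yQ; case: TM => _ _ _ TM1 _.
  have : #|joins le P [set b; y]| == 1.
    by apply/eqP/TM1; rewrite // inE bA andbT (atoms_ideal Pz P_ranked) // (negbTE nbQ).
  move/cards1P=> [j /(joins_set2 le_refl le_anti le_trans) lj].
  by rewrite (jn_lub2 le_refl le_anti le_trans lj).
split=> //.
- by move=> b /newP[].
- exact: ideal_projP.
- move=> b y bA yQ; have [bP nbQ bat] := newP b bA; have [jP bj yj jl] := jnP b y bA yQ.
  have [M MP jM] := exists_maxel jP; have bM := le_trans bj jM; have yM := le_trans yj jM.
  have lj : lub2 le (downset le P M) b y (jn le P b y).
    split=> //; first by rewrite mem_downset jP.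
    by move=> w; rewrite mem_downset => /andP[wP _]; apply: jl.
  have pb : p b = z.
    have [pQ pb _] := ideal_projP bP.
    case: (le_atom Pz P_ranked bat (QP pQ) pb) => // pbb.
    by rewrite -pbb pQ in nbQ.
  have := ideal_proj_lub MP bP bM yQ lj; rewrite pb => /(lub2_uniq le_anti); apply.
  by have [_ zl] := Pz; split; rewrite ?mem_downset ?(QP yQ) ?yM ?zl ?QP.
- move=> b x bA xP bx; have [bP nbQ _] := newP b bA; have [pQ px _] := ideal_projP xP.
  have nxQ : x \notin Q by apply: contra nbQ => xQ; apply: Q_down bx.
  have [jP bj pj jl] := jnP b (p x) bA pQ.
  apply: (covers_between (ideal_proj_covers xP nxQ)) => //; last exact: jl.
  by rewrite /lt pj; apply: contraNneq nbQ => e; apply: Q_down bP pQ _; rewrite e.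
exact: exists_new_atom.
Qed.

End TMIdeals.

End RankedPosets.

(** * Climbing the chain of TM-ideals *)

Theorem theorem1p3 (T : finType) (le : rel T)
  (le_refl : reflexive le) (le_anti : antisymmetric le) (le_trans : transitive le)
  (P : {set T}) :
  poset_ok le P -> locally_geometric le P -> strictly_supersolvable le P ->
  inductive_poset le P.
Proof.
move=> [/(has_hat0P le_anti)[z Pz] P_ranked] P_lg [r [Q [Q0 Qr Qstep Qrk]]].
have Qz i : i <= r -> z \in Q i.
  elim: i => [_|i IH lt_ir]; first by rewrite Q0 (least_botset le_anti Pz) set11.
  by have [/proper_sub/subsetP sQ _] := Qstep i lt_ir; apply/sQ/IH/ltnW.
have Qid i : i <= r -> order_ideal le P (Q i).
  (* Each term is only known to be an ideal of its successor, so the induction descends from Q r =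
     P. Being ideals of P, all terms inherit its ranking and local geometricity. *)
  move=> le_ir; rewrite -(subKn le_ir); elim: (r - i) (leq_subr i r) => [_|j IH lt_jr].
    by rewrite subn0 Qr; split.
  have lt_r : r - j.+1 < r by rewrite ltn_subrL (leq_ltn_trans _ lt_jr).
  have [_ [[sQ dQ] _ _ _ _]] := Qstep _ lt_r.
  have [sP dP] := IH (ltnW lt_jr); rewrite -subSn // subSS in sQ dQ.
  split=> [|x y xP yQ xy]; first exact: subset_trans sP.
  by apply: (dQ x y) => //; apply: (dP x y) => //; apply: (subsetP sQ).
rewrite -Qr; elim: {-2}r (leqnn r) => [_|i IH lt_ir].
  by rewrite Q0 (least_botset le_anti Pz); constructor.
have [_ TM] := Qstep i lt_ir; have id1 := Qid _ lt_ir; have z1 := Qz _ lt_ir.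
have z0 := Qz _ (ltnW lt_ir).
have lz : least le (Q i.+1) z := least_ideal Pz id1 z1.
have rk1 := ranked_ideal le_refl le_anti le_trans Pz P_ranked id1 z1.
have lg1 := lg_ideal P_lg id1.
apply: (extension_inductive le_refl le_anti le_trans lz rk1 lg1 z0 _ (IH (ltnW lt_ir))).
by apply: (TM_extension le_refl le_anti le_trans lz rk1 lg1 z0 TM); rewrite !Qrk // ltnW.
Qed.
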